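(* Let $\mathfrak g$ be a locally convex $\mathrm{ad}$-integrable Lie algebra, let $M$ be a locally convex manifold, and let $\beta:\mathfrak g\to\mathcal V(M)$ be a homomorphism of Lie algebras for which the map $\hat\beta:\mathfrak g\times M\to TM$, $(x,m)\mapsto\beta(x)(m)$, is smooth. Let $x\in\mathfrak g$, suppose that $\beta(x)$ is locally integrable, and write $\Phi^x$ for the corresponding local flow on $M$. Then $$(\Phi^x_{-t})_*\beta(y)=\beta(e^{t\,\mathrm{ad}\,x}y)|_{M_t}\quad\text{for}\quad y\in\mathfrak g,\ t\in\mathbb R.$$
   Context: Locally convex manifold: a (Hausdorff) smooth manifold modeled on a locally convex space; $\mathcal V(M)$ is the Lie algebra of smooth vector fields, with bracket $[X,Y](p)=\mathrm dY(p)X(p)-\mathrm dX(p)Y(p)$ in charts. A vector field $X$ is locally integrable if it is the velocity field $\frac{d}{dt}|_{t=0}\Phi_t$ of a smooth local flow; it then has a unique maximal local flow $\Phi^X:\mathcal D_X\to M$, $\mathcal D_X\subseteq\mathbb R\times M$ open. Put $M_t:=\{m\in M:(t,m)\in\mathcal D_X\}$ (here for $X=\beta(x)$, $\Phi^x:=\Phi^{\beta(x)}$); $\Phi^X_t:M_t\to M_{-t}$ is a diffeomorphism with inverse $\Phi^X_{-t}$. For $Y\in\mathcal V(M)$, $(\Phi^X_t)_*Y:=T(\Phi^X_t)\circ Y\circ\Phi^X_{-t}$, a vector field on $M_{-t}$. A locally convex Lie algebra $\mathfrak g$ is $\mathrm{ad}$-integrable if all linear vector fields $X_x(y):=[x,y]$,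 $x\in\mathfrak g$, generate global flows on $\mathfrak g$; then $e^{\mathrm{ad}\,x}:=\Phi_1^{X_x}$. *)

(* Defs.v *)
From HB Require Import structures.
From mathcomp Require Import all_boot all_order all_algebra.
From mathcomp Require Import all_classical all_reals all_analysis.

Set Implicit Arguments.
Unset Strict Implicit.
Unset Printing Implicit Defensive.

Import Order.TTheory GRing.Theory Num.Theory.
Import numFieldTopology.Exports numFieldNormedType.Exports.

Local Open Scope classical_set_scope.
Local Open Scope ring_scope.

(** Calculus in locally convex spaces, in the sense of Bastiani and Keller.
    [derive] of MathComp-Analysis requires normed modules, hence the analogous
    limits for [tvsType], the type of locally convex spaces.  That type does
    not include the Hausdorff property, which is a field of the records
    [lcManifold] and [lcLieAlgebra] below. *)
Section Calculus.
Variable R : realType.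

Definition diff_quotient (E F : tvsType R) (f : E -> F) (a v : E) : R -> F :=
  fun h => h^-1 *: (f (a + h *: v) - f a).

Definition dirderivable (E F : tvsType R) (f : E -> F) (a v : E) : Prop :=
  exists l : F, diff_quotient f a v @ 0^' --> l.

(* df(a)v; [lim] is not available since a [tvsType] is not declared pointed *)
Definition dirder (E F : tvsType R) (f : E -> F) (a v : E) : F :=
  xget 0 [set l : F | diff_quotient f a v @ 0^' --> l].

(* [Ck k U f]: on the open set U, f is C^k, where C^(k+1) means that f is
   continuous, that all directional derivatives exist, and that
   df : U x E -> F is C^k.  Values of f outside U are irrelevant. *)
Fixpoint Ck (k : nat) (E F : tvsType R) (U : set E) (f : E -> F) : Prop :=
  match k with
  | 0%N => {in U, continuous f}
  | k'.+1 => [/\ {in U, continuous f},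
                 forall a v, U a -> dirderivable f a v
               & @Ck k' (E * E)%type F (U `*` setT)
                     (fun p => dirder f p.1 p.2)]
  end.

Definition smooth (E F : tvsType R) (U : set E) (f : E -> F) : Prop :=
  open U /\ forall k, Ck k U f.

End Calculus.

(** The data of an atlas on M modeled on E: chart [ch_fun i] on [ch_dom i],
    with inverse [ch_inv i] (meaningful on the image of the chart only), and a
    preferred chart [ch_at p] around each point p.  The axioms of an atlas are
    in [is_atlas]. *)
Record charted (R : realType) (E : tvsType R) (M : Type) := Charted {
  ch_idx : Type;
  ch_dom : ch_idx -> set M;
  ch_fun : ch_idx -> M -> E;
  ch_inv : ch_idx -> E -> M;
  ch_at : M -> ch_idx }.

Section Charted.
Variable R : realType.

Definition model_charted (E : tvsType R) : charted E E :=
  @Charted R E E unit (fun=> setT) (fun=> id) (fun=> id) (fun=> tt).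

Definition prod_charted (E F : tvsType R) (M N : Type)
    (A : charted E M) (B : charted F N) : charted (E * F)%type (M * N) :=
  @Charted R (E * F)%type (M * N) (ch_idx A * ch_idx B)
    (fun ij => ch_dom ij.1 `*` ch_dom ij.2)
    (fun ij p => (ch_fun ij.1 p.1, ch_fun ij.2 p.2))
    (fun ij u => (ch_inv ij.1 u.1, ch_inv ij.2 u.2))
    (fun p => (ch_at A p.1, ch_at B p.2)).

(* Smoothness on U of a map between manifolds.  Openness of the domains of the
   local representatives amounts to U being open and f being continuous on U. *)
Definition smooth_on (E F : tvsType R) (M N : Type)
    (A : charted E M) (B : charted F N) (U : set M) (f : M -> N) : Prop :=
  forall (i : ch_idx A) (j : ch_idx B),
    smooth (ch_fun i @` (U `&` ch_dom i `&` f @^-1` ch_dom j))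
           (ch_fun j \o f \o ch_inv i).

Section Tangent.
Variables (E F : tvsType R) (M N : Type) (A : charted E M) (B : charted F N).

(* The tangent space T_pM is represented by E: v : E stands for the tangent
   vector at p whose coordinate in the preferred chart [ch_at A p] is v.  Thus
   TM is M * E as a set, and a vector field on M is a function M -> E. *)

(* the coordinate in the chart i of the tangent vector pv.2 at pv.1 *)
Definition tangent_coord (i : ch_idx A) (pv : M * E) : E :=
  let k := ch_at A pv.1 in
  dirder (ch_fun i \o ch_inv k) (ch_fun k pv.1) pv.2.

Definition tangent_charted : charted (E * E)%type (M * E) :=
  @Charted R (E * E)%type (M * E) (ch_idx A)
    (fun i => [set pv | ch_dom i pv.1])
    (fun i pv => (ch_fun i pv.1, tangent_coord i pv))
    (fun i uw => let p := ch_inv i uw.1 in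
                 (p, dirder (ch_fun (ch_at A p) \o ch_inv i) uw.1 uw.2))
    (fun pv => ch_at A pv.1).

(* Tf : TM -> TN *)
Definition tangent_map (f : M -> N) (pv : M * E) : N * F :=
  let p := pv.1 in
  (f p, dirder (ch_fun (ch_at B (f p)) \o f \o ch_inv (ch_at A p))
               (ch_fun (ch_at A p) p) pv.2).

(* the vector field X as a section M -> TM *)
Definition section (X : M -> E) (p : M) : M * E := (p, X p).

(* the principal part of X in the chart i *)
Definition vf_local (i : ch_idx A) (X : M -> E) (u : E) : E :=
  tangent_coord i (section X (ch_inv i u)).

Definition vf_bracket (X Y : M -> E) (p : M) : E :=
  let i := ch_at A p in
  let u := ch_fun i p in
  dirder (vf_local i Y) u (vf_local i X u) -
  dirder (vf_local i X) u (vf_local i Y u).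

End Tangent.

Definition smooth_vf (E : tvsType R) (M : Type) (A : charted E M)
    (X : M -> E) : Prop :=
  smooth_on A (tangent_charted A) setT (section X).

Record is_atlas (E : tvsType R) (M : topologicalType) (A : charted E M) : Prop
    := IsAtlas {
  ch_atP : forall p, ch_dom (ch_at A p) p;
  ch_dom_open : forall i : ch_idx A, open (ch_dom i);
  ch_img_open : forall i : ch_idx A, open (ch_fun i @` ch_dom i);
  ch_funK : forall i : ch_idx A, {in ch_dom i, cancel (ch_fun i) (ch_inv i)};
  ch_fun_cont : forall i : ch_idx A, {in ch_dom i, continuous (ch_fun i)};
  ch_inv_cont : forall i : ch_idx A,
    {in ch_fun i @` ch_dom i, continuous (ch_inv i)};
  ch_smooth : forall i j : ch_idx A,
    smooth (ch_fun i @` (ch_dom i `&` ch_dom j)) (ch_fun j \o ch_inv i) }.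

End Charted.

Arguments section {R E M} X p.

Record lcManifold (R : realType) (E : tvsType R) := LcManifold {
  mfd_carrier :> topologicalType;
  mfd_atlas : charted E mfd_carrier;
  mfd_model_hausdorff : hausdorff_space E;
  mfd_hausdorff : hausdorff_space mfd_carrier;
  mfd_atlasP : is_atlas mfd_atlas }.

Section Flows.
Variables (R : realType) (E : tvsType R) (M : topologicalType).
Variable A : charted E M.

Record is_local_flow (D : set (R^o * M)) (Phi : R^o * M -> M) : Prop :=
  IsLocalFlow {
  flow_open : open D;
  flow_dom0 : forall m, D (0, m);
  flow_itv : forall m, is_interval [set t : R | D (t, m)];
  flow_smooth : smooth_on (prod_charted (model_charted R^o) A) A D Phi;
  flow0 : forall m, Phi (0, m) = m;
  flowD : forall s t m, D (s, m) -> D (t, Phi (s, m)) -> D (t + s, m) ->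
    Phi (t, Phi (s, m)) = Phi (t + s, m) }.

(* (D, Phi) is a local flow whose velocity field (d/dt)_(t=0) Phi_t is X *)
Definition local_flow_of (X : M -> E) (D : set (R^o * M))
    (Phi : R^o * M -> M) : Prop :=
  is_local_flow D Phi /\
  forall m, tangent_map (model_charted R^o) A (fun t => Phi (t, m)) (0, 1)
            = section X m.

Definition vf_locally_integrable (X : M -> E) : Prop :=
  exists D Phi, local_flow_of X D Phi.

Definition maximal_local_flow_of (X : M -> E) (D : set (R^o * M))
    (Phi : R^o * M -> M) : Prop :=
  local_flow_of X D Phi /\
  forall D' Phi', local_flow_of X D' Phi' ->
    D' `<=` D /\ {in D', Phi' =1 Phi}.

Definition global_flow_of (X : M -> E) (Phi : R^o * M -> M) : Prop :=
  local_flow_of X setT Phi.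

(* (Phi_t)_* Y = T(Phi_t) \o Y \o Phi_(-t), as a map into TM; it is meaningful
   at the points m with (- t, m) in the domain of Phi. *)
Definition flow_pushforward (Phi : R^o * M -> M) (t : R) (Y : M -> E) (m : M) :
    M * E :=
  tangent_map A A (fun p => Phi (t, p)) (section Y (Phi (- t, m))).

End Flows.

(** Locally convex Lie algebras: the bracket is continuous. *)
Record lcLieAlgebra (R : realType) := LcLieAlgebra {
  lie_space :> tvsType R;
  lie_br : lie_space -> lie_space -> lie_space;
  lie_hausdorff : hausdorff_space lie_space;
  lie_linear_l : forall z, linear (lie_br ^~ z);
  lie_linear_r : forall x, linear (lie_br x);
  lie_alt : forall x, lie_br x x = 0;
  lie_jacobi : forall x y z, lie_br x (lie_br y z) + lie_br y (lie_br z x)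
                             + lie_br z (lie_br x y) = 0;
  lie_continuous : continuous (fun p : lie_space * lie_space =>
                                 lie_br p.1 p.2) }.

Section LieAlgebra.
Variables (R : realType) (g : lcLieAlgebra R).

Definition ad_integrable : Prop :=
  forall x : g, exists Phi,
    global_flow_of (model_charted g) (lie_br x) Phi.

(* e^(ad x) y = Phi_1(y), for the global flow Phi of the linear vector field
   ad x (unique if it exists) *)
Definition exp_ad (x y : g) : g :=
  xget 0 [set z | exists2 Phi,
    global_flow_of (model_charted g) (lie_br x) Phi & z = Phi (1, y)].

Record lie_hom (E : tvsType R) (M : Type) (A : charted E M)
    (beta : g -> M -> E) : Prop := LieHom {
  hom_smooth_vf : forall x, smooth_vf A (beta x);
  hom_linear : forall (a : R) x y m,
    beta (a *: x + y) m = a *: beta x m + beta y m;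
  hom_bracket : forall x y m,
    beta (lie_br x y) m = vf_bracket A (beta x) (beta y) m }.

(* hat beta : g x M -> TM *)
Definition hat (E : tvsType R) (M : Type) (beta : g -> M -> E)
    (xm : g * M) : M * E := section (beta xm.1) xm.2.

End LieAlgebra.

(* Main.v *)
Require Import Defs.
From HB Require Import structures.
From mathcomp Require Import all_boot all_order all_algebra.
From mathcomp Require Import all_classical all_reals all_analysis.
From mathcomp Require Import ring lra.

(** The pushforward formula says that a curve of tangent vectors is constant.
    Let z be the integral curve s |-> e^(s t ad x) y of the linear vector field
    t ad x.  For 0 <= u <= 1 the vector
      w u = T(Phi_(- u t)) (beta (z (1 - u)) (Phi_(u t) m))
    lies in the fixed tangent space at m; w 0 is beta (e^(t ad x) y) m and w 1 is
    the value at m of the pushforward of beta y.  So it suffices that w has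
    derivative 0.

    By the flow law and the chain rule, the derivative of w at u is the image
    under the linear map T(Phi_(- u t)) of the derivative at h = 0 of
      r h = T(Phi_(- h t)) (beta (z (1 - u - h)) (Phi_(h t) q)),  q = Phi_(u t) m.
    Write X and Y for the local forms of beta x and beta (z (1 - u)) in a chart
    around q.  The derivative of r has three terms: - t dX Y from the tangent map,
    t dY X from the moving base point, and beta (- t [x, z (1 - u)]) from z.
    Because beta respects brackets, the last one is - t (dY X - dX Y), and the sum
    is 0.  This is [pushforward_rate]; the first term is the content of
    [pushforward_derivative] and needs the symmetry of second derivatives
    ([dirder2_sym]).

    Calculus in locally convex spaces rests here on one mean value theorem
    ([mean_value_convex]): a curve over [0, 1] whose derivative stays in the
    interior of a convex set has its increment in that set.  It shows that a curve
    with derivative 0 is constant, and that C^1 maps are strictly differentiable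
    ([strict_derivative]), from which the chain rule, the linearity of
    differentials and the symmetry of second derivatives follow.

    The pushforward only makes sense once Phi_t m lies in the domain of Phi_(- t)
    ([maximal_flow_dom_inv]).  This is where maximality enters: adjoining to the
    domain D all points (s, p) that are reached in two steps inside D gives another
    local flow with the same velocity field ([extension_is_local_flow]), so D is
    closed under such compositions, and one can return from Phi_t m to m by
    composing short steps.

    The passages from local to global on [0, 1], for the mean value theorem as well
    as for flows, all use [cousin_induction]. *)

Set Implicit Arguments.
Unset Strict Implicit.
Unset Printing Implicit Defensive.

Import Order.TTheory GRing.Theory Num.Theory.
Import numFieldTopology.Exports numFieldNormedType.Exports.

Local Open Scope classical_set_scope.
Local Open Scope ring_scope.

(** * Limits and neighborhoods *)

Lemma cvg_congr_near T (U : topologicalType) (FF : set_system T)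
    {fFF : Filter FF} (f g : T -> U) (l : U) :
  (\forall x \near FF, f x = g x) -> f @ FF --> l -> g @ FF --> l.
Proof.
move=> fg fl A /fl; rewrite /= !nbhs_simpl /= => Af.
by apply: filterS2 fg Af => x /= <-.
Qed.

Lemma open_setX (S T : topologicalType) (A : set S) (B : set T) :
  open A -> open B -> open (A `*` B).
Proof.
move=> oA oB; rewrite openE => -[x y] [/= Ax By].
by exists (A, B) => //; split; exact: open_nbhs_nbhs.
Qed.

Lemma hausdorff_prod (S T : topologicalType) :
  hausdorff_space S -> hausdorff_space T -> hausdorff_space (S * T)%type.
Proof.
move=> hS hT [a b] [c d] cl; congr (_, _).
- apply: hS => A B nA nB.
  have [||[x y] [/= Ax Bx]] := cl (A `*` setT) (B `*` setT).
  + by exists (A, setT) => //; split => //; exact: filterT.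
  + by exists (B, setT) => //; split => //; exact: filterT.
  by exists x; split; [exact: Ax.1|exact: Bx.1].
- apply: hT => A B nA nB.
  have [||[x y] [/= Ax Bx]] := cl (setT `*` A) (setT `*` B).
  + by exists (setT, A) => //; split => //; exact: filterT.
  + by exists (setT, B) => //; split => //; exact: filterT.
  by exists y; split; [exact: Ax.2|exact: Bx.2].
Qed.

Lemma near_open (T : topologicalType) (a : T) (P : T -> Prop) :
  (\forall b \near a, P b) -> exists2 U, open_nbhs a U & forall b, U b -> P b.
Proof.
by move=> aP; have : nbhs a [set b | P b] by []; rewrite nbhsE => -[U]; exists U.
Qed.

Lemma near_nbhs_near (T : topologicalType) (a : T) (P : T -> Prop) :
  (\forall b \near a, P b) -> \forall b \near a, \forall c \near b, P c.
Proof. by move=> aP; exact: (nbhs_interior aP). Qed.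

Lemma cvg_pair_point S (T U : topologicalType) (FF : set_system S) {fFF : Filter FF}
    (f : S -> T) (g : S -> U) (a : T) (b : U) :
  f @ FF --> a -> g @ FF --> b ->
  (fun x => (f x, g x)) @ FF --> ((a, b) : (T * U)%type).
Proof. exact: cvg_pair. Qed.

Lemma near_fst (S T : topologicalType) (a : S) (b : T) (P : S -> Prop) :
  (\forall x \near a, P x) -> \forall p \near (a, b), P p.1.
Proof.
move=> aP; exists ([set x | P x], setT) => //=; last by move=> p [].
by split => //=; exact: filterT.
Qed.

Lemma near_snd (S T : topologicalType) (a : S) (b : T) (P : T -> Prop) :
  (\forall y \near b, P y) -> \forall p \near (a, b), P p.2.
Proof.
move=> bP; exists (setT, [set y | P y]) => //=; last by move=> p [].
by split => //=; exact: filterT.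
Qed.

Lemma near_continuous (S T : topologicalType) (f : S -> T) (a : S) (P : T -> Prop) :
  f @ a --> f a -> (\forall y \near f a, P y) -> \forall x \near a, P (f x).
Proof. by move=> cf; exact: cf. Qed.

Lemma continuous_congr_near (S T : topologicalType) (f g : S -> T) (a : S) :
  (\forall b \near a, f b = g b) -> f @ a --> f a -> g @ a --> g a.
Proof. by move=> fg; rewrite (nbhs_singleton fg); exact: cvg_congr_near. Qed.

Section TvsLimits.
Variable R : realType.

Lemma tvs_cvgD (E : tvsType R) T (F : set_system T) {FF : Filter F}
    (f g : T -> E) (a b : E) :
  f @ F --> a -> g @ F --> b -> (fun x => f x + g x) @ F --> a + b.
Proof.
move=> fa gb; apply: (cvg_comp2 fa gb).
exact: (@add_continuous E (a, b)).
Qed.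

Lemma tvs_cvgN (E : tvsType R) T (F : set_system T) {FF : Filter F}
    (f : T -> E) (a : E) :
  f @ F --> a -> (fun x => - f x) @ F --> - a.
Proof.
move=> fa; apply: (cvg_comp _ _ fa).
exact: (@opp_continuous E a).
Qed.

Lemma tvs_cvgB (E : tvsType R) T (F : set_system T) {FF : Filter F}
    (f g : T -> E) (a b : E) :
  f @ F --> a -> g @ F --> b -> (fun x => f x - g x) @ F --> a - b.
Proof. by move=> fa gb; apply: tvs_cvgD => //; exact: tvs_cvgN. Qed.

Lemma tvs_cvgZ (E : tvsType R) T (F : set_system T) {FF : Filter F}
    (k : T -> R) (f : T -> E) (l : R) (a : E) :
  k @ F --> l -> f @ F --> a -> (fun x => k x *: f x) @ F --> l *: a.
Proof.
move=> kl fa; apply: (@cvg_comp2 _ _ _ _ F _ _ _ _ _ _ k f (fun x y => x *: y) kl fa).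
exact: (@scale_continuous R E (l, a)).
Qed.

End TvsLimits.

Section PuncturedNeighborhoods.
Variable R : realType.
Implicit Types E : tvsType R.

Lemma dnbhs0_cvg0 : (id : R -> R) @ 0^' --> (0 : R).
Proof. exact: (@nbhs_dnbhs R 0). Qed.

Lemma cvg_dnbhs0_id : (fun h : R => h) @ (0 : R)^' --> (0 : R)^'.
Proof. exact: cvg_id. Qed.

Lemma cvg_dnbhs_neq T (F : set_system T) (k : T -> R) :
  k @ F --> (0 : R)^' -> \forall x \near F, k x != 0.
Proof.
move=> kF; apply: (kF [set h : R | h != 0]).
rewrite nbhs_simpl; exact: (@nbhs_dnbhs_neq R 0).
Qed.

Lemma near_dnbhs0_neq0 : \forall h \near (0 : R)^', h != 0.
Proof. exact: cvg_dnbhs_neq cvg_dnbhs0_id. Qed.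

Lemma cvg_line E (a v : E) : (fun h : R => a + h *: v) @ 0^' --> a.
Proof.
have -> : nbhs a = nbhs (a + 0 *: v) by rewrite scale0r addr0.
apply: tvs_cvgD; first exact: cvg_cst.
apply: tvs_cvgZ; [exact: dnbhs0_cvg0|exact: cvg_cst].
Qed.

Lemma cvg_dnbhs0M (c : R) : c != 0 -> (fun h : R => h * c) @ 0^' --> (0 : R)^'.
Proof.
move=> c0 A; rewrite /dnbhs /= => nA.
have Mc : (fun h => h * c) @ (0 : R) --> (0 : R).
  rewrite -[X in _ --> X](mul0r c).
  by apply: cvgM; [exact: cvg_id|exact: cvg_cst].
have H : \forall h \near (0 : R), h * c != 0 -> A (h * c).
  exact: Mc nA.
change (\forall h \near (0 : R), h != 0 -> A (h * c)).
near=> h => h0; have /(_ _) : h * c != 0 -> A (h * c) by near: h.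
by apply; rewrite mulf_eq0 negb_or h0.
Unshelve. all: by end_near. Qed.

Lemma cvg_speed (s t : R) : (fun r : R => (r - s) * t) @ s --> (0 : R).
Proof.
rewrite -[X in _ --> X](mul0r t) -(subrr s).
apply: cvgM; last exact: cvg_cst.
by apply: cvgB; [exact: cvg_id|exact: cvg_cst].
Qed.

Lemma near_speed (P : R -> Prop) (s t : R) :
  (\forall h \near (0 : R), P h) -> \forall r \near s, P ((r - s) * t).
Proof. by move=> nP; exact: (@cvg_speed s t [set h | P h] nP). Qed.

Lemma near_dnbhs0_scale (P : R -> Prop) (t : R) :
  (\forall h \near (0 : R), P h) -> \forall h \near (0 : R)^', P (h * t).
Proof.
move=> nP; have n1 : \forall h \near (0 : R), P (h * t).
  by apply: filterS (near_speed 0 t nP) => h; rewrite subr0.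
exact: (@dnbhs0_cvg0 [set h | P (h * t)]).
Qed.

End PuncturedNeighborhoods.

(** * Induction on intervals and the mean value theorem *)

(** Cousin's lemma as an induction principle: otherwise the supremum of the b such
    that P 0 b would contradict the local hypothesis at that supremum.  In the local
    hypothesis only intervals [a, b] that contain s matter, as in a tagged partition. *)
Lemma cousin_induction (R : realType) (P : R -> R -> Prop) :
  (forall a b c, a <= b -> b <= c -> P a b -> P b c -> P a c) ->
  (forall s : R, 0 <= s <= 1 -> exists2 A : set R, nbhs s A &
     forall a b, A a -> A b -> 0 <= a <= s -> s <= b <= 1 -> P a b) ->
  P 0 1.
Proof.
move=> Padd Ploc.
have Ploc_ball s : 0 <= s <= 1 -> exists2 d, 0 < d &
    forall a b, s - d < a -> b < s + d -> 0 <= a <= s -> s <= b <= 1 -> P a b.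
  move=> /Ploc[A /nbhs_ballP[d /= d0 dA] PA].
  exists d => // a b sa bs /andP[a0 as_] /andP[sb b1].
  apply: PA; rewrite ?a0 ?sb ?as_ ?b1//; apply: dA;
    by rewrite /ball/= ltr_norml; apply/andP; split; lra.
pose S := [set b | 0 <= b <= 1 /\ P 0 b].
have S0 : S 0.
  split; first by rewrite lexx ler01.
  have [|d d0] := Ploc_ball 0; first by rewrite lexx ler01.
  by apply; rewrite ?lexx ?ler01//; lra.
have supS : has_sup S by split; [exists 0|exists 1 => b [/andP[]]].
have S_le b : S b -> b <= sup S by exact: ub_le_sup (supS.2) _.
have s01 : 0 <= sup S <= 1.
  rewrite S_le//=; apply: ge_sup; first by exists 0.
  by move=> b [/andP[]].
have [d d0 Pd] := Ploc_ball _ s01.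
have [b [/andP[b0 b1] Pb] sb] := sup_adherent d0 supS.
have bs : b <= sup S by apply: S_le; rewrite /S/= b0 b1.
have Pbc c : sup S <= c <= 1 -> c < sup S + d -> P 0 c.
  move=> /andP[sc c1] cs; apply: (Padd _ b) => //; first exact: le_trans sc.
  by apply: Pd; rewrite ?b0 ?bs ?sc ?c1.
have [s1|s1] := leP 1 (sup S).
  by apply: Pbc; [rewrite lexx andbT|]; move/andP: s01 => [? ?]; lra.
pose c := Num.min 1 (sup S + d / 2).
have sc : sup S < c by rewrite lt_min s1/=; lra.
have c1 : c <= 1 by rewrite ge_min lexx.
have cd : c < sup S + d by rewrite gt_min; apply/orP; right; lra.
have : c <= sup S.
  apply: S_le; split; last by apply: Pbc; rewrite ?(ltW sc) ?c1.
  by move/andP: s01 => [? ?]; rewrite c1 andbT; lra.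
by rewrite leNgt sc.
Qed.

Section MeanValue.
Variables (R : realType) (F : tvsType R).

Lemma convex_comb (V : set F) (u v : F) (k : R) :
  convex_set V -> 0 <= k <= 1 -> V u -> V v -> V (k *: u + (1 - k) *: v).
Proof.
move=> cV /andP[k0 k1] Vu Vv.
have ki : Itv.spec (@Itv.num_sem R) (Itv.Real `[0%Z, 1%Z]) k.
  by rewrite /=/Itv.num_sem/= ger0_real//= in_itv/= k0 k1.
have := cV u v (Itv.mk ki) (mem_set Vu) (mem_set Vv).
by move/set_mem.
Qed.

Lemma locally_convex_nbhs (a : F) (A : set F) :
  nbhs a A -> exists2 V, convex_set V & open_nbhs a V /\ V `<=` A.
Proof.
move=> aA; have [B cB [oB bB]] := @locally_convex R F.
have [V [BV Va VA]] := bB a A aA.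
by exists V => //; [exact/cB/mem_set|split => //; split => //; exact: oB].
Qed.

(** The mean slope over [a, c] is a convex combination of the mean slopes over [a, b]
    and [b, c], so having its mean slope in V is an additive property of an interval.
    It holds for short intervals that have s as an end point, since the slopes there
    tend to a point of the interior of V. *)
Lemma mean_value_convex (V : set F) (f : R^o -> F) : convex_set V ->
  (forall s : R, 0 <= s <= 1 ->
    exists2 l : F, diff_quotient f s 1 @ 0^' --> l & nbhs l V) ->
  V (f 1 - f 0).
Proof.
move=> cV df.
pose q a b := (b - a)^-1 *: (f b - f a).
pose P a b := a < b -> V (q a b).
have qC a b : q a b = q b a.
  by rewrite /q -(opprB a b) -(opprB (f a)) invrN scaleNr scalerN opprK.
suff : P 0 1 by rewrite /P /q subr0 invr1 scale1r; apply; exact: ltr01.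
have Padd a b c : a <= b -> b <= c -> P a b -> P b c -> P a c.
  rewrite !le_eqVlt => /predU1P[->//|ab] /predU1P[<-//|bc] /(_ ab) Pab /(_ bc) Pbc ac.
  pose k := (b - a) / (c - a).
  have ca : c - a != 0 by rewrite subr_eq0 gt_eqF.
  have ba : b - a != 0 by rewrite subr_eq0 gt_eqF.
  have cb : c - b != 0 by rewrite subr_eq0 gt_eqF.
  have -> : q a c = k *: q a b + (1 - k) *: q b c.
    rewrite /q !scalerA.
    have -> : k * (b - a)^-1 = (c - a)^-1 by rewrite /k; field; rewrite ca ba.
    have -> : (1 - k) * (c - b)^-1 = (c - a)^-1 by rewrite /k; field; rewrite ca cb.
    by rewrite -scalerDr [f b - _ + _]addrC addrA subrK.
  apply: convex_comb => //; apply/andP; split.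
    by rewrite divr_ge0 ?subr_ge0 ?ltW.
  by rewrite ler_pdivrMr ?subr_gt0// mul1r lerD2r ltW.
apply: cousin_induction => // s s01.
have [l dfl Vl] := df s s01.
have : \forall h \near 0^', V (diff_quotient f s 1 h) by exact: dfl.
rewrite near_withinE => nV.
exists [set r | r != s -> V (q s r)].
  have : \forall r \near s, r - s != 0 -> V (diff_quotient f s 1 (r - s)).
    have : (fun r => r - s) @ s --> (0 : R).
      by rewrite -[X in _ --> X](subrr s); apply: cvgB; [exact: cvg_id|exact: cvg_cst].
    by move/(_ _ nV).
  apply: filterS => r /=; rewrite subr_eq0 => /[apply].
  by rewrite /diff_quotient /q /= [(r - s) *: 1]mulr1 (addrC s) subrK.
move=> a b /= Va Vb /andP[_ as_] /andP[sb _].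
apply: (Padd _ s) => //.
- by move=> lt_as; rewrite qC; apply: Va; rewrite lt_eqF.
- by move=> lt_sb; apply: Vb; rewrite gt_eqF.
Qed.

(** By local convexity and the mean value theorem, the increment lies in every
    neighborhood of 0. *)
Lemma eq_of_zero_derivative (f : R^o -> F) : hausdorff_space F ->
  (forall s : R, 0 <= s <= 1 -> diff_quotient f s 1 @ 0^' --> (0 : F)) ->
  f 0 = f 1.
Proof.
move=> hF df; apply: subr0_eq; apply/oppr_inj; rewrite opprB oppr0.
apply: (hF (f 1 - f 0) 0) => A B nA nB.
have [V cV [[oV V0] VB]] := locally_convex_nbhs nB.
exists (f 1 - f 0); split; first exact: nbhs_singleton.
apply: VB; apply: (mean_value_convex (f := f) cV) => s s01.
by exists 0; [exact: df|exact: open_nbhs_nbhs].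
Qed.

End MeanValue.

(** * Strict differentiability *)

Section StrictDerivative.
Variable R : realType.
Implicit Types E F : tvsType R.

Lemma convex_segment E (A : set E) (a b : E) (s : R) : convex_set A ->
  A a -> A (a + b) -> 0 <= s <= 1 -> A (a + s *: b).
Proof.
move=> cA Aa Aab s01.
have -> : a + s *: b = s *: (a + b) + (1 - s) *: a.
  by rewrite scalerDr scalerBl scale1r addrAC addrCA subrr addr0 addrC.
exact: convex_comb.
Qed.

Lemma diff_quotient_line E F (f : E -> F) (b v : E) (h s k : R) :
  diff_quotient (fun s : R^o => h^-1 *: f (b + s *: (h *: v))) s 1 k =
  diff_quotient f (b + s *: (h *: v)) v (k * h).
Proof.
rewrite /diff_quotient -scalerBr (scalerA k^-1) -invfM [k *: 1]mulr1.
congr (_ *: (f _ - _)).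
by rewrite scalerDl addrA (scalerA k).
Qed.

Lemma mean_value_segment E F (f : E -> F) (df : E -> F) (A : set E) (V : set F)
    (b v : E) (h : R) : h != 0 -> convex_set A -> convex_set V ->
  A b -> A (b + h *: v) ->
  (forall c, A c -> diff_quotient f c v @ 0^' --> df c /\ nbhs (df c) V) ->
  V (h^-1 *: (f (b + h *: v) - f b)).
Proof.
move=> h0 cA cV Ab Abh dfV.
pose g (s : R^o) := h^-1 *: f (b + s *: (h *: v)).
have -> : h^-1 *: (f (b + h *: v) - f b) = g 1 - g 0.
  by rewrite /g scale1r scale0r addr0 scalerBr.
apply: mean_value_convex => // s s01.
have [dfc Vdf] := dfV (b + s *: (h *: v)) (convex_segment cA Ab Abh s01).
exists (df (b + s *: (h *: v))) => //.
have -> : diff_quotient g s 1 = fun k => diff_quotient f (b + s *: (h *: v)) v (k * h).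
  by apply/funext => k; exact: diff_quotient_line.
exact: (cvg_comp _ _ (cvg_dnbhs0M h0) dfc).
Qed.

Lemma subr_interchange (V : zmodType) (a b c d : V) :
  a - b - (c - d) = a - c - (b - d).
Proof. by rewrite !opprB [d - c]addrC [d - b]addrC addrACA. Qed.

(** Joint continuity of the differential makes the difference quotient converge even
    when the base point and the direction move.  The base point moves in a convex
    neighborhood, so the whole segment from b to b + h v stays near a, and the mean
    value theorem applies along it. *)
Lemma strict_derivative E F (f : E -> F) (df : E * E -> F) (a v : E) :
  (\forall p \near (a, v), diff_quotient f p.1 p.2 @ 0^' --> df p) ->
  {for (a, v), continuous df} ->
  (fun p : E * (R * E) => p.2.1^-1 *: (f (p.1 + p.2.1 *: p.2.2) - f p.1))
    @ filter_prod (nbhs a) (filter_prod 0^' (nbhs v)) --> df (a, v).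
Proof.
move=> dfE dfC W nW.
have [V cV [[oV Vdf] VW]] := locally_convex_nbhs nW.
have : \forall p \near (a, v), diff_quotient f p.1 p.2 @ 0^' --> df p /\ V (df p).
  by apply: filterI => //; apply: dfC; exact: open_nbhs_nbhs.
case=> -[A B] /= [nA nB] AB.
have [A' cA' [[oA' A'a] A'A]] := locally_convex_nbhs nA.
have nA' : nbhs a A' by exact: open_nbhs_nbhs.
pose FF := filter_prod (nbhs a) (filter_prod (0 : R)^' (nbhs v)).
have c1 : (fun p : E * (R * E) => p.1) @ FF --> a by exact: cvg_fst.
have c21 : (fun p : E * (R * E) => p.2.1) @ FF --> (0 : R)^'.
  by apply: (cvg_comp _ _ cvg_snd); exact: cvg_fst.
have c22 : (fun p : E * (R * E) => p.2.2) @ FF --> v.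
  by apply: (cvg_comp _ _ cvg_snd); exact: cvg_snd.
have c3 : (fun p : E * (R * E) => p.1 + p.2.1 *: p.2.2) @ FF --> a.
  have -> : nbhs a = nbhs (a + 0 *: v) by rewrite scale0r addr0.
  apply: tvs_cvgD => //; apply: tvs_cvgZ => //.
  exact: (cvg_trans c21 (@dnbhs0_cvg0 R)).
have h0 : \forall p \near FF, p.2.1 != 0 by exact: cvg_dnbhs_neq c21.
have h1 := c1 _ nA'; have h3 := c3 _ nA'; have h2 := c22 _ nB.
near_simpl; near=> p; apply: VW => /=.
apply: (@mean_value_segment E F f (fun c => df (c, p.2.2)) A' V p.1 p.2.2 p.2.1) => //.
- by near: p.
- by near: p.
- by near: p.
- move=> c A'c; have Bp : B p.2.2 by near: p.
  have [? ?] := AB (c, p.2.2) (conj (A'A _ A'c) Bp).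
  by split => //; exact: open_nbhs_nbhs.
Unshelve. all: by end_near. Qed.

(** The mean value theorem along v for the function b |-> (f (b + h w) - f b) / h,
    whose derivative along v is the difference quotient of fv in the direction w.
    The limit is the iterated derivative of f along v, then w, while the second
    difference itself is symmetric in v and w. *)
Lemma second_difference_cvg E F (f fv : E -> F) (a v w : E) (l : F) :
  (\forall b \near a, diff_quotient f b v @ 0^' --> fv b) ->
  (fun p : E * R => p.2^-1 *: (fv (p.1 + p.2 *: w) - fv p.1))
    @ filter_prod (nbhs a) 0^' --> l ->
  (fun h : R => h^-1 *: (h^-1 *: (f (a + h *: v + h *: w) - f (a + h *: v))
                         - h^-1 *: (f (a + h *: w) - f a))) @ 0^' --> l.
Proof.
move=> dfv dfvw W nW.
have [V cV [[oV Vl] VW]] := locally_convex_nbhs nW.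
have [[A B] /= [nA nB] AB] := dfvw V (open_nbhs_nbhs (conj oV Vl)).
have [A' cA' [[oA' A'a] A'A]] := locally_convex_nbhs (filterI nA dfv).
have nA' : nbhs a A' by exact: open_nbhs_nbhs.
near_simpl; near=> h; apply: VW => /=.
have h0 : h != 0 by near: h; exact: nbhs_dnbhs_neq.
pose g b := h^-1 *: (f (b + h *: w) - f b).
apply: (mean_value_segment (f := g) (A := [set b | A' b /\ A' (b + h *: w)])
  (df := fun b => h^-1 *: (fv (b + h *: w) - fv b)) h0 _ cV) => //.
- move=> x y k /set_mem[A'x A'xw] /set_mem[A'y A'yw]; apply: mem_set; split.
    by apply/set_mem/cA'; exact: mem_set.
  have := set_mem (cA' _ _ k (mem_set A'xw) (mem_set A'yw)).
  congr A'; rewrite /conv/= !scalerDr addrACA; congr (_ + _).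
  by rewrite -scalerDl addrC subrK scale1r.
- by split => //; near: h; apply: cvg_line.
- split; first by near: h; apply: cvg_line.
  near: h; have : (fun h : R => a + h *: v + h *: w) @ 0^' --> a + 0 *: w.
    apply: tvs_cvgD; first exact: cvg_line.
    by apply: tvs_cvgZ; [exact: (@dnbhs0_cvg0 R)|exact: cvg_cst].
  by apply; rewrite scale0r addr0.
- move=> c [A'c A'cw]; split.
    have -> : diff_quotient g c v = fun k => h^-1 *:
        (diff_quotient f (c + h *: w) v k - diff_quotient f c v k).
      apply/funext => k; rewrite /diff_quotient /g -!scalerBr !scalerA mulrC.
      by congr (_ *: _); rewrite (addrAC c) subr_interchange.
    apply: tvs_cvgZ; first exact: cvg_cst.
    apply: tvs_cvgB; [exact: (A'A _ A'cw).2|exact: (A'A _ A'c).2].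
  apply: open_nbhs_nbhs; split=> //.
  apply: (AB (c, h)); split => /=; first exact: (A'A _ A'c).1.
  by near: h.
Unshelve. all: by end_near. Qed.

End StrictDerivative.

(** * Germs of C^k maps *)

Section CkAt.
Variable R : realType.
Implicit Types E F G : tvsType R.

Definition Ck_at k E F (f : E -> F) (a : E) : Prop :=
  exists2 U, open_nbhs a U & Ck k U f.

Lemma Ck_continuous k E F (U : set E) (f : E -> F) :
  Ck k U f -> {in U, continuous f}.
Proof. by case: k => [|k] // []. Qed.

Lemma Ck_pred k E F (U : set E) (f : E -> F) : Ck k.+1 U f -> Ck k U f.
Proof.
elim: k E F U f => [|k IH] E F U f; first by case.
by move=> [cf df /IH].
Qed.

Lemma Ck_at_pred k E F (f : E -> F) a : Ck_at k.+1 f a -> Ck_at k f a.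
Proof. by move=> [U aU /Ck_pred]; exists U. Qed.

Lemma Ck_at1 k E F (f : E -> F) a : Ck_at k.+1 f a -> Ck_at 1 f a.
Proof. by elim: k => // k IH /Ck_at_pred. Qed.

Lemma Ck_at_near k E F (f : E -> F) a :
  Ck_at k f a -> \forall b \near a, Ck_at k f b.
Proof.
move=> [U [oU Ua] cU]; have : nbhs a U by exact: open_nbhs_nbhs.
by apply: filterS => b Ub; exists U.
Qed.

Lemma Ck_at_continuous k E F (f : E -> F) a : Ck_at k f a -> f @ a --> f a.
Proof. by move=> [U [oU Ua] /Ck_continuous]; apply; rewrite inE. Qed.

Lemma dirder_cvg E F (f : E -> F) a v : dirderivable f a v ->
  diff_quotient f a v @ 0^' --> dirder f a v.
Proof. by move=> dfv; exact: (xgetPex 0 dfv). Qed.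

Lemma dirderE E F (f : E -> F) a v l : hausdorff_space F ->
  diff_quotient f a v @ 0^' --> l -> dirder f a v = l.
Proof.
move=> hF fl; have dfv : dirderivable f a v by exists l.
exact: (cvg_unique hF (dirder_cvg dfv) fl).
Qed.

Lemma dirder_quotient E E' F (f : E -> F) (f' : E' -> F) a v a' v' :
  diff_quotient f a v =1 diff_quotient f' a' v' -> dirder f a v = dirder f' a' v'.
Proof. by move=> /funext eq_dq; rewrite /dirder eq_dq. Qed.

Lemma pairDZ E F (a v : E) (b w : F) (h : R) :
  ((a, b) : (E * F)%type) + h *: ((v, w) : (E * F)%type) = (a + h *: v, b + h *: w).
Proof. by []. Qed.

Lemma dirder_slice E1 E2 F (f : (E1 * E2)%type -> F) a u v :
  dirder (fun w => f (a, w)) u v = dirder f (a, u) (0, v).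
Proof.
by apply: dirder_quotient => h; rewrite /diff_quotient pairDZ /= scaler0 addr0.
Qed.

Lemma Ck_at_dirderivable k E F (f : E -> F) a v : Ck_at k.+1 f a ->
  diff_quotient f a v @ 0^' --> dirder f a v.
Proof. by move=> [U [_ Ua] [_ dfU _]]; exact/dirder_cvg/dfU. Qed.

Lemma Ck_at_dirder k E F (f : E -> F) a v : Ck_at k.+1 f a ->
  Ck_at k (fun p => dirder f p.1 p.2) (a, v).
Proof.
move=> [U [oU Ua] [_ _ cU]]; exists (U `*` setT) => //; split => //.
exact: open_setX oU openT.
Qed.

Lemma Ck_at_strict k E F (f : E -> F) a v : Ck_at k.+1 f a ->
  (fun p : E * (R * E) => p.2.1^-1 *: (f (p.1 + p.2.1 *: p.2.2) - f p.1))
    @ filter_prod (nbhs a) (filter_prod 0^' (nbhs v)) --> dirder f a v.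
Proof.
move=> cf; apply: (strict_derivative (df := fun p => dirder f p.1 p.2)).
  have [A nA Af] : exists2 A, nbhs a A & A `<=` Ck_at k.+1 f.
    by exists (Ck_at k.+1 f) => //; exact: Ck_at_near.
  exists (A, setT); first by split => //=; exact: filterT.
  by move=> p [/= /Af cfp _]; exact: Ck_at_dirderivable cfp.
exact: (Ck_at_continuous (Ck_at_dirder v cf)).
Qed.

(** The chain rule along an arbitrary filter: c x is a + h x * (a vector that tends to
    v), and strict differentiability allows for the moving direction. *)
Lemma Ck_at_chain k E F (f : E -> F) a v T (FF : set_system T) {fFF : Filter FF}
    (h : T -> R) (c : T -> E) : Ck_at k.+1 f a ->
  h @ FF --> 0^' -> (fun x => (h x)^-1 *: (c x - a)) @ FF --> v ->
  (fun x => (h x)^-1 *: (f (c x) - f a)) @ FF --> dirder f a v.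
Proof.
move=> cf h0 cv.
have aa : (fun _ : T => a) @ FF --> a by exact: cvg_cst.
have H : (fun x => (h x)^-1 *: (f (a + h x *: ((h x)^-1 *: (c x - a))) - f a))
    @ FF --> dirder f a v.
  exact: (cvg_comp _ _ (cvg_pair aa (cvg_pair h0 cv)) (Ck_at_strict (v := v) cf)).
apply: (cvg_congr_near _ H).
near=> x => /=; rewrite scalerA divff ?scale1r; last by near: x; exact: cvg_dnbhs_neq.
by rewrite addrCA subrr addr0.
Unshelve. all: by end_near. Qed.

Lemma dirder_near E F (f g : E -> F) a v :
  (\forall b \near a, f b = g b) -> dirder f a v = dirder g a v.
Proof.
move=> fg; rewrite /dirder; congr (xget _ _); apply/seteqP.
have eq_dq : \forall h \near (0 : R)^', diff_quotient f a v h = diff_quotient g a v h.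
  have fga : f a = g a by exact: nbhs_singleton fg.
  have fgl : \forall h \near (0 : R)^', f (a + h *: v) = g (a + h *: v).
    exact: (cvg_line v fg).
  by near=> h; rewrite /diff_quotient fga; congr (_ *: (_ - _)); near: h.
split => l /=; apply: cvg_congr_near => //.
by apply: filterS eq_dq => h.
Unshelve. all: by end_near. Qed.

Lemma dirderivable_near E F (f g : E -> F) a v :
  (\forall b \near a, f b = g b) -> dirderivable f a v -> dirderivable g a v.
Proof.
move=> fg [l fl]; exists l; apply: (cvg_congr_near _ fl).
have fga : f a = g a by exact: nbhs_singleton fg.
have fgl : \forall h \near (0 : R)^', f (a + h *: v) = g (a + h *: v).
  exact: (cvg_line v fg).
by near=> h; rewrite /diff_quotient fga; congr (_ *: (_ - _)); near: h.
Unshelve. all: by end_near. Qed.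

Lemma diff_quotientZ E F (f : E -> F) a v (c : R) h : c != 0 ->
  diff_quotient f a (c *: v) h = c *: diff_quotient f a v (h * c).
Proof.
by move=> c0; rewrite /diff_quotient !scalerA invfM (mulrC h^-1) mulrA divff// mul1r.
Qed.

Lemma linear_zero E F (L : E -> F) : linear L -> L 0 = 0.
Proof. by move=> lL; have := lL (- 1) 0 0; rewrite scaler0 addr0 scaleN1r addNr. Qed.

Lemma linear_scale E F (L : E -> F) k u : linear L -> L (k *: u) = k *: L u.
Proof. by move=> lL; have := lL k u 0; rewrite (linear_zero lL) !addr0. Qed.

(** For the additivity, move first along v, then along c u: the second increment
    starts at the moving point a + h v, which strict differentiability allows. *)
Lemma dirder_linear k E F (f : E -> F) a : hausdorff_space F -> Ck_at k.+1 f a ->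
  linear (dirder f a).
Proof.
move=> hF cf.
have dfZ c v : dirder f a (c *: v) = c *: dirder f a v.
  apply: dirderE => //.
  have [->|c0] := eqVneq c 0.
    rewrite !scale0r; have -> : diff_quotient f a 0 = fun=> 0.
      by apply/funext => h; rewrite /diff_quotient scaler0 addr0 subrr scaler0.
    exact: cvg_cst.
  have -> : diff_quotient f a (c *: v) = fun h => c *: diff_quotient f a v (h * c).
    by apply/funext => h; exact: diff_quotientZ.
  apply: tvs_cvgZ; first exact: cvg_cst.
  exact: (cvg_comp _ _ (cvg_dnbhs0M c0) (Ck_at_dirderivable (v := v) cf)).
move=> c u v; rewrite -dfZ; apply: dirderE => //.
have -> : diff_quotient f a (c *: u + v) = fun h =>
    h^-1 *: (f ((a + h *: v) + h *: (c *: u)) - f (a + h *: v)) + diff_quotient f a v h.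
  apply/funext => h; rewrite /diff_quotient -scalerDr addrA subrK.
  by rewrite -addrA -scalerDr [v + _]addrC.
apply: tvs_cvgD; last exact: Ck_at_dirderivable cf.
have uu : (fun _ : R => c *: u) @ (0 : R)^' --> c *: u by exact: cvg_cst.
have hh := @cvg_dnbhs0_id R.
exact: (cvg_comp _ _ (cvg_pair (@cvg_line _ _ a v) (cvg_pair hh uu))
  (Ck_at_strict (v := c *: u) cf)).
Qed.

Lemma dirder_comp k l E F G (f : E -> F) (g : F -> G) a v : hausdorff_space G ->
  Ck_at k.+1 f a -> Ck_at l.+1 g (f a) ->
  dirder (g \o f) a v = dirder g (f a) (dirder f a v).
Proof.
move=> hG cf cg; apply: dirderE => //.
exact: (Ck_at_chain cg (@cvg_dnbhs0_id R) (Ck_at_dirderivable (v := v) cf)).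
Qed.

(** The germ of the differential at (a, v) depends only on the germ of f at a, so
    regularity can be checked point by point. *)
Lemma Ck_local k E F (U : set E) (f : E -> F) :
  (forall a, U a -> Ck_at k f a) -> Ck k U f.
Proof.
elim: k E F U f => [|k IH] E F U f Uf.
  by move=> a /set_mem /Uf; exact: Ck_at_continuous.
split.
- by move=> a /set_mem /Uf; exact: Ck_at_continuous.
- by move=> a v /Uf cf; exists (dirder f a v); exact: Ck_at_dirderivable cf.
- by apply: IH => -[a v] [/= /Uf cf _]; exact: Ck_at_dirder.
Qed.

Lemma Ck_at0P E F (f : E -> F) a :
  (\forall b \near a, f @ b --> f b) -> Ck_at 0 f a.
Proof.
move=> /near_open[U aU Uf]; exists U => //.
by move=> b /set_mem /Uf.
Qed.

Lemma Ck_atSP k E F (f : E -> F) a :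
  (\forall b \near a, f @ b --> f b /\
    forall v, dirderivable f b v /\ Ck_at k (fun p => dirder f p.1 p.2) (b, v)) ->
  Ck_at k.+1 f a.
Proof.
move=> /near_open[U aU Uf]; exists U => //; split.
- by move=> b /set_mem /Uf [].
- by move=> b v /Uf [_ /(_ v) []].
- by apply: Ck_local => -[b v] [/= /Uf [_ /(_ v) []]].
Qed.

Lemma Ck_at_congr k E F (f g : E -> F) a :
  (\forall b \near a, f b = g b) -> Ck_at k f a -> Ck_at k g a.
Proof.
elim: k E F f g a => [|k IH] E F f g a /near_nbhs_near fg /Ck_at_near cf.
  apply: Ck_at0P; apply: filterS2 fg cf => b bfg /Ck_at_continuous.
  exact: continuous_congr_near.
apply: Ck_atSP; apply: filterS2 fg cf => b bfg cf; split.
  by apply: continuous_congr_near bfg _; exact: Ck_at_continuous cf.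
move=> v; split.
  apply: (dirderivable_near bfg).
  by exists (dirder f b v); exact: Ck_at_dirderivable cf.
apply: IH (Ck_at_dirder v cf).
apply: filterS (near_fst v (near_nbhs_near bfg)) => p /= pfg.
exact: dirder_near.
Qed.

Lemma Ck_at_linear_comp k E F G (L : E -> F) (g : F -> G) a :
  linear L -> continuous L -> Ck_at k g (L a) -> Ck_at k (g \o L) a.
Proof.
elim: k E F G L g a => [|k IH] E F G L g a lL cL /Ck_at_near cg.
all: have {}cg := near_continuous (cL a) cg.
  apply: Ck_at0P; apply: filterS cg => b /Ck_at_continuous cgb.
  exact: (cvg_comp _ _ (cL b) cgb).
apply: Ck_atSP; apply: filterS cg => b cgb; split.
  exact: (cvg_comp _ _ (cL b) (Ck_at_continuous cgb)).
have dqL c v : diff_quotient (g \o L) c v = diff_quotient g (L c) (L v).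
  by apply/funext => h; rewrite /diff_quotient /= [c + _]addrC lL [L c + _]addrC.
move=> v; split.
  by exists (dirder g (L b) (L v)); rewrite dqL; exact: Ck_at_dirderivable cgb.
pose LL (p : E * E) := (L p.1, L p.2).
have -> : (fun p : E * E => dirder (g \o L) p.1 p.2) =
    (fun p : F * F => dirder g p.1 p.2) \o LL.
  by apply/funext => p; rewrite /= /dirder dqL.
apply: IH.
- by move=> c p q; rewrite /LL/= !lL.
- move=> p; apply: cvg_pair.
  + exact: (cvg_comp _ _ (@cvg_fst _ _ (nbhs p.1) (nbhs p.2) _) (cL p.1)).
  + exact: (cvg_comp _ _ (@cvg_snd _ _ (nbhs p.1) (nbhs p.2) _) (cL p.2)).
- exact: Ck_at_dirder.
Qed.

(** The differential of x |-> L x + c is (x, v) |-> L v, of the same form on the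
    product, so the induction on k closes on itself. *)
Lemma Ck_at_affine k E F (L : E -> F) (c : F) a : hausdorff_space F ->
  linear L -> continuous L -> Ck_at k (fun x => L x + c) a.
Proof.
move=> hF; elim: k E L c a => [|k IH] E L c a lL cL.
all: have cLc b : (fun x => L x + c) @ b --> L b + c
  by apply: tvs_cvgD; [exact: cL|exact: cvg_cst].
  by apply: Ck_at0P; near=> b; exact: cLc.
apply: Ck_atSP; near=> b; split; first exact: cLc.
have dL x v : diff_quotient (fun x => L x + c) x v @ 0^' --> L v.
  apply: (@cvg_congr_near _ _ _ _ (fun _ : R => L v)); last exact: cvg_cst.
  apply: filterS (@near_dnbhs0_neq0 R) => h h0; rewrite /diff_quotient [x + _]addrC lL.
  by rewrite opprD addrACA subrr addr0 addrK scalerA mulVf// scale1r.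
move=> v; split; first by exists (L v).
apply: (@Ck_at_congr _ _ _ (fun p : E * E => L p.2 + 0)).
  by near=> p; rewrite addr0 (dirderE hF (dL p.1 p.2)).
apply: IH => [d p q|p]; first exact: lL.
exact: (cvg_comp _ _ (@cvg_snd _ _ (nbhs p.1) (nbhs p.2) _) (cL p.2)).
Unshelve. all: by end_near. Qed.

Lemma cvg_diff_quotient_pair E F G (f : E -> F) (g : E -> G) a v l m :
  diff_quotient f a v @ 0^' --> l -> diff_quotient g a v @ 0^' --> m ->
  diff_quotient (fun x => (f x, g x)) a v @ 0^' --> ((l, m) : (F * G)%type).
Proof.
move=> fl gm.
have -> : diff_quotient (fun x => (f x, g x)) a v =
  fun h => (diff_quotient f a v h, diff_quotient g a v h) by [].
exact: cvg_pair.
Qed.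

Lemma Ck_at_pair k E F G (f : E -> F) (g : E -> G) a :
  hausdorff_space F -> hausdorff_space G ->
  Ck_at k f a -> Ck_at k g a -> Ck_at k (fun x => (f x, g x)) a.
Proof.
move=> hF hG; elim: k E f g a => [|k IH] E f g a /Ck_at_near cf /Ck_at_near cg.
  apply: Ck_at0P; apply: filterS2 cf cg => b cf cg.
  by apply: cvg_pair; [exact: Ck_at_continuous cf|exact: Ck_at_continuous cg].
have dfg b : Ck_at k.+1 f b -> Ck_at k.+1 g b -> forall v,
    diff_quotient (fun x => (f x, g x)) b v @ 0^'
      --> ((dirder f b v, dirder g b v) : (F * G)%type).
  move=> cfb cgb v; apply: cvg_diff_quotient_pair.
  - exact: Ck_at_dirderivable cfb.
  - exact: Ck_at_dirderivable cgb.
apply: Ck_atSP; apply: filterS2 cf cg => b cf cg; split.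
  by apply: cvg_pair; [exact: Ck_at_continuous cf|exact: Ck_at_continuous cg].
move=> v; split; first by exists (dirder f b v, dirder g b v); exact: dfg.
apply: Ck_at_congr (IH _ _ _ _ (Ck_at_dirder v cf) (Ck_at_dirder v cg)).
have nfg : \forall c \near b, Ck_at k.+1 f c /\ Ck_at k.+1 g c.
  by apply: filterI; exact: Ck_at_near.
apply: filterS (near_fst v nfg) => p [cfp cgp]; apply/esym/dirderE.
  exact: hausdorff_prod.
exact: dfg.
Qed.

(** Induction on k: the differential of g \o f is (x, v) |-> dg (f x) (df x v), again a
    composition, of the differential of g with the pair (f x, df x v). *)
Lemma Ck_at_comp k E F G (f : E -> F) (g : F -> G) a :
  hausdorff_space F -> hausdorff_space G ->
  Ck_at k f a -> Ck_at k g (f a) -> Ck_at k (g \o f) a.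
Proof.
move=> hF hG; elim: k E F G f g a hF hG => [|k IH] E F G f g a hF hG cfa cga.
all: have cf := Ck_at_near cfa.
all: have cg := near_continuous (Ck_at_continuous cfa) (Ck_at_near cga).
  apply: Ck_at0P; apply: filterS2 cf cg => b /= cf cg.
  exact: (cvg_comp _ _ (Ck_at_continuous cf) (Ck_at_continuous cg)).
apply: Ck_atSP; apply: filterS2 (cf) (near_nbhs_near cg) => b cfb cgb; split.
  exact: (cvg_comp _ _ (Ck_at_continuous cfb) (Ck_at_continuous (nbhs_singleton cgb))).
move=> v; split.
  exists (dirder g (f b) (dirder f b v)).
  exact: (Ck_at_chain (nbhs_singleton cgb) (@cvg_dnbhs0_id R)
    (Ck_at_dirderivable (v := v) cfb)).
have cfb1 : Ck_at k (fun p : E * E => f p.1) (b, v).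
  apply: (@Ck_at_linear_comp _ _ _ _ fst f) => [//||]; last exact: Ck_at_pred.
  by move=> p; exact: cvg_fst.
have cpair := Ck_at_pair hF hF cfb1 (Ck_at_dirder v cfb).
have := IH _ _ _ _ (fun p => dirder g p.1 p.2) _ (hausdorff_prod hF hF) hG cpair
  (Ck_at_dirder _ (nbhs_singleton cgb)).
apply: Ck_at_congr.
have nfg : \forall c \near b, Ck_at k.+1 f c /\ Ck_at k.+1 g (f c).
  by apply: filterI => //; exact: Ck_at_near.
by apply: filterS (near_fst v nfg) => p [cfp cgp] /=; rewrite (dirder_comp _ hG cfp cgp).
Qed.

End CkAt.

(** * Second derivatives and rates of curves *)

Section SecondDerivative.
Variable R : realType.
Implicit Types E F : tvsType R.

Lemma cvg_rate_pair E F (f : R -> E) (g : R -> F) a b l m :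
  (fun h => h^-1 *: (f h - a)) @ 0^' --> l ->
  (fun h => h^-1 *: (g h - b)) @ 0^' --> m ->
  (fun h => h^-1 *: ((f h, g h) - ((a, b) : (E * F)%type))) @ 0^'
    --> ((l, m) : (E * F)%type).
Proof.
move=> fl gm.
have -> : (fun h => h^-1 *: ((f h, g h) - ((a, b) : (E * F)%type))) =
  fun h => (h^-1 *: (f h - a), h^-1 *: (g h - b)) by [].
exact: cvg_pair.
Qed.

Lemma cvg_rate_cst E (a : E) : (fun h : R => h^-1 *: (a - a)) @ 0^' --> (0 : E).
Proof.
apply: (@cvg_congr_near _ _ _ _ (fun _ : R => (0 : E))); last exact: cvg_cst.
by near=> h; rewrite subrr scaler0.
Unshelve. all: by end_near. Qed.

Lemma cvg_rate_linear E (v : E) : (fun h : R => h^-1 *: (h *: v - 0)) @ 0^' --> v.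
Proof.
apply: (@cvg_congr_near _ _ _ _ (fun _ : R => v)); last exact: cvg_cst.
by apply: filterS (@near_dnbhs0_neq0 R) => h h0; rewrite subr0 scalerA mulVf// scale1r.
Qed.

(** Both sides are limits of one and the same second difference quotient. *)
Lemma dirder2_sym E F (f : E -> F) (a v w : E) : hausdorff_space F -> Ck_at 2 f a ->
  dirder (fun p => dirder f p.1 p.2) (a, v) (w, 0) =
  dirder (fun p => dirder f p.1 p.2) (a, w) (v, 0).
Proof.
move=> hF cf.
have second_difference v' w' :
    (fun h : R => h^-1 *: (h^-1 *: (f (a + h *: v' + h *: w') - f (a + h *: v'))
                        - h^-1 *: (f (a + h *: w') - f a))) @ 0^' -->
    dirder (fun p => dirder f p.1 p.2) (a, v') (w', 0).
  apply: (second_difference_cvg (fv := fun b => dirder f b v')).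
    by apply: filterS (Ck_at_near cf) => b; exact: Ck_at_dirderivable.
  have c1 : (fun p : E * R => (p.1, v')) @ filter_prod (nbhs a) 0^' --> (a, v').
    by apply: cvg_pair; [exact: cvg_fst|exact: cvg_cst].
  have c2 : (fun p : E * R => p.2) @ filter_prod (nbhs a) 0^' --> (0 : R)^'.
    exact: cvg_snd.
  have c3 : (fun=> (w', 0)) @ filter_prod (nbhs a) (0 : R)^'
      --> ((w', 0) : (E * E)%type).
    exact: cvg_cst.
  have -> : (fun p : E * R =>
        p.2^-1 *: (dirder f (p.1 + p.2 *: w') v' - dirder f p.1 v')) =
      (fun q : (E * E) * (R * (E * E)) => q.2.1^-1 *: (dirder f (q.1 + q.2.1 *: q.2.2).1
         (q.1 + q.2.1 *: q.2.2).2 - dirder f q.1.1 q.1.2)) \o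
      (fun p : E * R => ((p.1, v'), (p.2, (w', 0)))).
    by apply/funext => p /=; rewrite scaler0 addr0.
  exact: (cvg_comp _ _ (cvg_pair c1 (cvg_pair c2 c3))
    (Ck_at_strict (v := (w', 0)) (Ck_at_dirder v' cf))).
apply: (cvg_unique hF (second_difference v w)).
apply: (cvg_congr_near _ (second_difference w v)); near=> h.
rewrite -!scalerBr; congr (_ *: (_ *: _)).
by rewrite (addrAC a) subr_interchange.
Unshelve. all: by end_near. Qed.

Lemma local_flow_rate (E : tvsType R) (phi : (R^o * E)%type -> E) (u0 : E) (t : R) :
  hausdorff_space E -> Ck_at 1 phi (0, u0) -> phi (0, u0) = u0 ->
  (fun h => h^-1 *: (phi (h * t, u0) - u0)) @ 0^' --> t *: dirder phi (0, u0) (1, 0).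
Proof.
move=> hE cphi phi0.
have dc : (fun h => h^-1 *: ((h * t, u0) - ((0, u0) : (R^o * E)%type))) @ (0 : R)^'
    --> ((t, 0) : (R^o * E)%type).
  by apply: cvg_rate_pair; [exact: (@cvg_rate_linear R^o t)|exact: cvg_rate_cst].
have : (fun h => h^-1 *: (phi (h * t, u0) - phi (0, u0))) @ (0 : R)^'
  --> dirder phi (0, u0) (t, 0) by exact: (Ck_at_chain cphi (@cvg_dnbhs0_id R) dc).
rewrite phi0 -(linear_scale _ _ (dirder_linear hE cphi)).
have -> // : ((t, 0) : (R^o * E)%type) = t *: ((1, 0) : (R^o * E)%type).
by apply: injective_projections => /=; rewrite ?scaler0// [RHS]mulr1.
Qed.

(** The product rule for h |-> T(Phi_(- h t)) (b h) at the moving point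
    Phi_(h t) u0, for a local flow phi in a vector space with velocity field
    X u = d/ds phi (s, u) at s = 0.  The tangent map is the differential of phi in
    the direction (0, b h).  It is the identity at time 0, and its time derivative
    there is the differential of X by the symmetry of second derivatives. *)
Lemma pushforward_derivative E (phi : (R^o * E)%type -> E) (u0 : E) (b : R -> E)
    (b' : E) (t : R) :
  hausdorff_space E -> Ck_at 2 phi (0, u0) -> (\forall u \near u0, phi (0, u) = u) ->
  (fun h => h^-1 *: (b h - b 0)) @ 0^' --> b' ->
  (fun h => h^-1 *: (dirder phi (- (h * t), phi (h * t, u0)) (0, b h) - b 0)) @ 0^'
    --> b' - t *: dirder (fun u => dirder phi (0, u) (1, 0)) u0 (b 0).
Proof.
move=> hE cphi phi0 db.
pose b0 := b 0; pose X0 := dirder phi (0, u0) (1, 0).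
have du : (fun h => h^-1 *: (phi (h * t, u0) - u0)) @ 0^' --> t *: X0.
  by apply: local_flow_rate (nbhs_singleton phi0) => //; exact: Ck_at1 cphi.
pose Dphi (p : (R^o * E) * (R^o * E)) := dirder phi p.1 p.2.
have cD : Ck_at 1 Dphi ((0, u0), (0, b0)) by exact: Ck_at_dirder.
have lD := dirder_linear hE cD.
(* phi (0, _) is the identity near u0, hence so is its differential *)
have D0 u v : (\forall w \near u, phi (0, w) = w) -> dirder phi (0, u) (0, v) = v.
  move=> phiu; rewrite -dirder_slice (dirder_near v phiu); apply: dirderE => //.
  apply: (@cvg_congr_near _ _ _ _ (fun _ : R => v)); last exact: cvg_cst.
  apply: filterS (@near_dnbhs0_neq0 R) => h h0.
  by rewrite /diff_quotient addrC addKr scalerA mulVf// scale1r.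
have D0b0 : Dphi ((0, u0), (0, b0)) = b0 by exact: D0.
have dc : (fun h => h^-1 *: (((- (h * t), phi (h * t, u0)), (0, b h)) -
      (((0, u0), (0, b0)) : ((R^o * E) * (R^o * E))%type))) @ (0 : R)^'
    --> (((- t, t *: X0), (0, b')) : ((R^o * E) * (R^o * E))%type).
  apply: cvg_rate_pair; apply: cvg_rate_pair => //; last exact: cvg_rate_cst.
  apply: (cvg_congr_near _ (@cvg_rate_linear R^o (- t))); near=> h.
  by rewrite [h *: _]mulrN.
have : (fun h => h^-1 *: (Dphi ((- (h * t), phi (h * t, u0)), (0, b h)) -
    Dphi ((0, u0), (0, b0)))) @ (0 : R)^'
    --> dirder Dphi ((0, u0), (0, b0)) ((- t, t *: X0), (0, b')).
  exact: (Ck_at_chain cD (@cvg_dnbhs0_id R) dc).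
rewrite D0b0.
suff -> : dirder Dphi ((0, u0), (0, b0)) ((- t, t *: X0), (0, b')) =
  b' - t *: dirder (fun u => dirder phi (0, u) (1, 0)) u0 b0 by [].
have -> : ((- t, t *: X0), (0, b')) =
    (- t) *: (((1, 0), (0, 0)) : ((R^o * E) * (R^o * E))%type) + ((0, t *: X0), (0, b')).
  apply: injective_projections; apply: injective_projections => /=;
    by rewrite ?scaler0 ?addr0 ?add0r// [RHS]mulr1.
rewrite lD addrC scaleNr; congr (_ - _ *: _).
- (* along (0, v) both the base point and the vector stay at time 0 *)
  apply: dirderE => //.
  apply: (@cvg_congr_near _ _ _ _ (fun _ : R => b')); last exact: cvg_cst.
  have := cvg_line (t *: X0) (near_nbhs_near phi0).
  apply: filterS2 (@near_dnbhs0_neq0 R) => h h0 phih.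
  rewrite /diff_quotient D0b0 /Dphi !pairDZ /= !scaler0 !addr0 D0//.
  by rewrite addrC addKr scalerA mulVf// scale1r.
- rewrite (@dirder2_sym (R^o * E)%type E phi (0, u0) (0, b0) (1, 0) hE cphi).
  apply: dirder_quotient.
  by move=> h; rewrite /diff_quotient !pairDZ /= !scaler0 !addr0.
Unshelve. all: by end_near. Qed.

(** The partial differential in the linear variable is B itself, so that only the
    other one remains as a derivative. *)
Lemma bilinear_derivative E F (B : (F * E)%type -> E) (z : R -> F) (u : R -> E) z' u' :
  hausdorff_space E -> Ck_at 1 B (z 0, u 0) -> linear (fun x => B (x, u 0)) ->
  (fun h => h^-1 *: (z h - z 0)) @ 0^' --> z' ->
  (fun h => h^-1 *: (u h - u 0)) @ 0^' --> u' ->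
  (fun h => h^-1 *: (B (z h, u h) - B (z 0, u 0))) @ 0^'
    --> B (z', u 0) + dirder (fun x => B (z 0, x)) (u 0) u'.
Proof.
move=> hE cB lB dz du.
have dzu : (fun h => h^-1 *: ((z h, u h) - (z 0, u 0))) @ 0^'
    --> ((z', u') : (F * E)%type).
  exact: cvg_rate_pair.
have : (fun h => h^-1 *: (B (z h, u h) - B (z 0, u 0))) @ (0 : R)^'
    --> dirder B (z 0, u 0) (z', u') by exact: (Ck_at_chain cB (@cvg_dnbhs0_id R) dzu).
have <- : dirder B (z 0, u 0) (z', 0) = B (z', u 0).
  apply: dirderE => //.
  apply: (@cvg_congr_near _ _ _ _ (fun _ : R => B (z', u 0))); last exact: cvg_cst.
  apply: filterS (@near_dnbhs0_neq0 R) => h h0.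
  rewrite /diff_quotient pairDZ /= scaler0 addr0 [z 0 + _]addrC lB addrK scalerA mulVf//.
  by rewrite scale1r.
rewrite dirder_slice.
have := dirder_linear hE cB 1 (z', 0) (0, u'); rewrite !scale1r => <-.
have -> // : (z', 0) + (0, u') = ((z', u') : (F * E)%type).
by apply: injective_projections; rewrite /= ?addr0 ?add0r.
Qed.

End SecondDerivative.

(** * C^k maps between manifolds *)

Section Charts.
Variables (R : realType) (E : tvsType R) (M : topologicalType) (A : charted E M).
Hypothesis aA : is_atlas A.
Implicit Types (i j : ch_idx A) (p : M).

Lemma chart_funK i p : ch_dom i p -> ch_inv i (ch_fun i p) = p.
Proof. by move=> ip; apply: (ch_funK aA); exact: mem_set. Qed.

Lemma chart_dom_near i p : ch_dom i p -> \forall q \near p, ch_dom i q.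
Proof. by move=> ip; apply: open_nbhs_nbhs; split => //; exact: ch_dom_open. Qed.

Lemma chart_fun_cvg i p : ch_dom i p -> ch_fun i @ p --> ch_fun i p.
Proof. by move=> ip; apply: (ch_fun_cont aA); exact: mem_set. Qed.

Lemma chart_inv_cvg i p : ch_dom i p -> ch_inv i @ (ch_fun i p) --> p.
Proof.
move=> ip; rewrite -[X in _ --> X](chart_funK ip).
by apply: (ch_inv_cont aA); apply: mem_set; exists p.
Qed.

Lemma near_chart_inv i p (P : M -> Prop) : ch_dom i p ->
  (\forall q \near p, P q) -> \forall u \near ch_fun i p, P (ch_inv i u).
Proof. by move=> ip; exact: chart_inv_cvg. Qed.

Lemma chart_inv_near i p : ch_dom i p ->
  \forall u \near ch_fun i p, ch_dom i (ch_inv i u) /\ ch_fun i (ch_inv i u) = u.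
Proof.
move=> ip; have : nbhs (ch_fun i p) (ch_fun i @` ch_dom i).
  apply: open_nbhs_nbhs; split; first exact: ch_img_open.
  by exists p.
by apply: filterS => _ [q iq <-]; rewrite chart_funK.
Qed.

Lemma Ck_at_transition k i j p : ch_dom i p -> ch_dom j p ->
  Ck_at k (ch_fun j \o ch_inv i) (ch_fun i p).
Proof.
move=> ip jp; have [oU cU] := ch_smooth aA i j.
exists (ch_fun i @` (ch_dom i `&` ch_dom j)) => //.
by split => //; exists p.
Qed.

End Charts.

(** Continuity is a separate condition because a chart has meaningless values outside
    its domain: the regularity of the local representative alone does not keep f q in
    the chart of N for q near p. *)
Definition Ck_map_at (R : realType) (E F : tvsType R) (M N : topologicalType)
    (A : charted E M) (B : charted F N) (k : nat) (f : M -> N) (p : M) : Prop :=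
  f @ p --> f p /\
  Ck_at k (ch_fun (ch_at B (f p)) \o f \o ch_inv (ch_at A p)) (ch_fun (ch_at A p) p).

Section ChangeOfCharts.
Variables (R : realType) (E F : tvsType R) (M N : topologicalType).
Variables (A : charted E M) (B : charted F N).
Hypotheses (aA : is_atlas A) (aB : is_atlas B).
Hypotheses (hE : hausdorff_space E) (hF : hausdorff_space F).

Lemma Ck_at_change_charts k (f : M -> N) p (i i' : ch_idx A) (j j' : ch_idx B) :
  ch_dom i p -> ch_dom i' p -> ch_dom j (f p) -> ch_dom j' (f p) ->
  f @ p --> f p ->
  Ck_at k (ch_fun j \o f \o ch_inv i) (ch_fun i p) ->
  Ck_at k (ch_fun j' \o f \o ch_inv i') (ch_fun i' p).
Proof.
move=> ip i'p jfp j'fp cf cij.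
have c1 := Ck_at_transition aA k i'p ip.
have c2 : Ck_at k ((ch_fun j \o f \o ch_inv i) \o (ch_fun i \o ch_inv i')) (ch_fun i' p).
  by apply: Ck_at_comp => //=; rewrite (chart_funK aA).
have c3 : Ck_at k ((ch_fun j' \o ch_inv j) \o
    ((ch_fun j \o f \o ch_inv i) \o (ch_fun i \o ch_inv i'))) (ch_fun i' p).
  apply: Ck_at_comp => //=; rewrite !(chart_funK aA)//.
  exact: (Ck_at_transition aB).
apply: Ck_at_congr c3.
have n1 : \forall q \near p, ch_dom i q /\ ch_dom j (f q).
  apply: filterI; first exact: (chart_dom_near aA).
  exact: near_continuous cf (chart_dom_near aB jfp).
have := near_chart_inv aA i'p n1.
apply: filterS => u /= [iu ju].
by rewrite !(chart_funK aA)// (chart_funK aB).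
Qed.

Lemma Ck_map_atP k (f : M -> N) p (i : ch_idx A) (j : ch_idx B) :
  ch_dom i p -> ch_dom j (f p) ->
  Ck_map_at A B k f p <->
  f @ p --> f p /\ Ck_at k (ch_fun j \o f \o ch_inv i) (ch_fun i p).
Proof.
move=> ip jp; have := ch_atP aA p; have := ch_atP aB (f p) => jp' ip'.
split=> -[cf ck]; split => //.
  exact: (Ck_at_change_charts ip' ip jp' jp cf ck).
exact: (Ck_at_change_charts ip ip' jp jp' cf ck).
Qed.

Lemma Ck_map_at_congr k (f g : M -> N) p :
  (\forall q \near p, f q = g q) -> Ck_map_at A B k f p -> Ck_map_at A B k g p.
Proof.
move=> fg [cf ck]; split; first exact: continuous_congr_near fg cf.
rewrite -(nbhs_singleton fg); apply: Ck_at_congr ck.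
have := near_chart_inv aA (ch_atP aA p) fg.
by apply: filterS => u /= ->.
Qed.

Lemma smooth_on_Ck_map_at k (U : set M) (f : M -> N) p :
  smooth_on A B U f -> U p -> Ck_map_at A B k f p.
Proof.
move=> sf Up; set i := ch_at A p; set j := ch_at B (f p).
have ip : ch_dom i p := ch_atP aA p.
have jfp : ch_dom j (f p) := ch_atP aB (f p).
have [oS cS] := sf i j.
set S := U `&` ch_dom i `&` f @^-1` ch_dom j in oS cS.
have Sp : S p by split.
have nS : nbhs (ch_fun i p) (ch_fun i @` S).
  by apply: open_nbhs_nbhs; split => //; exists p.
have ck k' : Ck_at k' (ch_fun j \o f \o ch_inv i) (ch_fun i p).
  exists (ch_fun i @` S) => //; split => //; by exists p.
split; last exact: ck.
(* near p, f is the composition of its local representative with the charts *)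
have c0 : (ch_fun j \o f \o ch_inv i) @ ch_fun i p --> ch_fun j (f p).
  have := Ck_at_continuous (ck 0%N).
  by rewrite /= (chart_funK aA ip).
have := cvg_comp _ _ (cvg_comp _ _ (chart_fun_cvg aA ip) c0) (chart_inv_cvg aB jfp).
apply: cvg_congr_near.
have := near_continuous (chart_fun_cvg aA ip) nS.
have := chart_dom_near aA ip; apply: filterS2 => q iq /= [q' [[Uq' iq'] jq'] eqq].
have <- : q' = q by rewrite -(chart_funK aA iq') eqq (chart_funK aA).
by rewrite /= (chart_funK aA iq') (chart_funK aB jq').
Qed.

Lemma Ck_map_at_smooth_on (U : set M) (f : M -> N) :
  open U -> (forall k p, U p -> Ck_map_at A B k f p) -> smooth_on A B U f.
Proof.
move=> oU Uf i j; split; last first.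
  move=> k; apply: Ck_local => _ [p [[Up ip] jp] <-].
  by have [_] := (Ck_map_atP k ip jp).1 (Uf k p Up).
rewrite openE => _ [p [[Up ip] jp] <-].
have n1 : \forall q \near p, U q /\ ch_dom i q /\ ch_dom j (f q).
  apply: filterI; first exact: open_nbhs_nbhs.
  apply: filterI; first exact: (chart_dom_near aA).
  exact: near_continuous (Uf 0%N p Up).1 (chart_dom_near aB jp).
have := chart_inv_near aA ip.
have := near_chart_inv aA ip n1.
apply: filterS2 => u /= [Uu [iu ju]] [_ fu].
by exists (ch_inv i u).
Qed.

End ChangeOfCharts.

Section CkMapConstructions.
Variables (R : realType) (E F G : tvsType R) (M N P : topologicalType).
Variables (A : charted E M) (B : charted F N) (C : charted G P).
Hypotheses (aA : is_atlas A) (aB : is_atlas B).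
Hypotheses (hE : hausdorff_space E) (hF : hausdorff_space F) (hG : hausdorff_space G).

Lemma near_chart_comp (f : M -> N) (g : N -> P) p
    (i : ch_idx A) (j : ch_idx B) (l : ch_idx C) :
  ch_dom i p -> ch_dom j (f p) -> f @ p --> f p ->
  \forall u \near ch_fun i p,
    ((ch_fun l \o g \o ch_inv j) \o (ch_fun j \o f \o ch_inv i)) u =
    (ch_fun l \o (g \o f) \o ch_inv i) u.
Proof.
move=> ip jp cf; have := near_continuous cf (chart_dom_near aB jp).
move=> /(near_chart_inv aA ip); apply: filterS => u /= ju.
by rewrite (chart_funK aB).
Qed.

Lemma Ck_map_at_comp k (f : M -> N) (g : N -> P) p :
  Ck_map_at A B k f p -> Ck_map_at B C k g (f p) -> Ck_map_at A C k (g \o f) p.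
Proof.
move=> [cf ckf] [cg ckg]; split; first exact: (cvg_comp _ _ cf cg).
have ip := ch_atP aA p; have jp := ch_atP aB (f p).
apply: (Ck_at_congr (near_chart_comp g (ch_at C (g (f p))) ip jp cf)).
by apply: Ck_at_comp => //=; rewrite (chart_funK aA).
Qed.

Lemma Ck_map_at_pair k (f : M -> N) (g : M -> P) p :
  Ck_map_at A B k f p -> Ck_map_at A C k g p ->
  Ck_map_at A (prod_charted B C) k (fun q => (f q, g q)) p.
Proof.
move=> [cf ckf] [cg ckg]; split; first exact: cvg_pair.
exact: (Ck_at_pair hF hG ckf ckg).
Qed.

Lemma Ck_map_at_id k p : Ck_map_at A A k id p.
Proof.
split; first exact: cvg_id.
apply: (@Ck_at_congr _ _ _ _ (fun u => u + 0)).
  by apply: filterS (chart_inv_near aA (ch_atP aA p)) => u /= [_ ->]; rewrite addr0.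
by apply: (@Ck_at_affine _ k _ _ id) => // x; exact: cvg_id.
Qed.

Lemma Ck_map_at_fst k (p : M * N) : Ck_map_at (prod_charted A B) A k fst p.
Proof.
split; first exact: cvg_fst.
have n1 := chart_inv_near aA (ch_atP aA p.1).
apply: (@Ck_at_congr _ _ _ _ (fun u => u.1 + 0)).
  by apply: filterS (near_fst _ n1) => u /= [_ ->]; rewrite addr0.
apply: (Ck_at_affine k 0 _ hE) => // u; exact: cvg_fst.
Qed.

Lemma Ck_map_at_snd k (p : M * N) : Ck_map_at (prod_charted A B) B k snd p.
Proof.
split; first exact: cvg_snd.
have n1 := chart_inv_near aB (ch_atP aB p.2).
apply: (@Ck_at_congr _ _ _ _ (fun u => u.2 + 0)).
  by apply: filterS (near_snd _ n1) => u /= [_ ->]; rewrite addr0.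
apply: (Ck_at_affine k 0 _ hF) => // u; exact: cvg_snd.
Qed.

Lemma Ck_map_at_cst k (c : N) p : Ck_map_at A B k (fun=> c) p.
Proof.
split; first exact: cvg_cst.
apply: (@Ck_at_congr _ _ _ _ (fun=> 0 + ch_fun (ch_at B c) c)).
  by near=> u; rewrite /= add0r.
apply: (@Ck_at_affine _ k _ _ (fun=> 0)) => // [d u v|u]; last exact: cvg_cst.
by rewrite scaler0 addr0.
Unshelve. all: by end_near. Qed.

Lemma Ck_map_at_translation k (a u : E) :
  Ck_map_at (model_charted E) (model_charted E) k (fun x => x + a) u.
Proof.
split.
  by apply: (@tvs_cvgD _ _ _ _ _ id); [exact: cvg_id|exact: cvg_cst].
by apply: (@Ck_at_affine _ k _ _ id) => // x; exact: cvg_id.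
Qed.

Lemma prod_is_atlas : is_atlas (prod_charted A B).
Proof.
have imgX (S : set M) (T : set N) (i : ch_idx A) (j : ch_idx B) :
    (fun p => (ch_fun i p.1, ch_fun j p.2)) @` (S `*` T) =
    (ch_fun i @` S) `*` (ch_fun j @` T).
  apply/seteqP; split => [_ [p [Sp Tp] <-]|[u v] [/= [x Sx <-] [y Ty <-]]].
    by split; [exists p.1|exists p.2].
  by exists (x, y).
split.
- by move=> p; split; exact: ch_atP.
- by move=> [i j]; apply: open_setX; exact: ch_dom_open.
- by move=> [i j]; rewrite /= imgX; apply: open_setX; exact: ch_img_open.
- by move=> [i j] [p q] /set_mem [/= ip jq]; rewrite !chart_funK.
- move=> [i j] [p q] /set_mem [/= ip jq]; apply: cvg_pair => /=.
    apply: (cvg_comp _ _ (@cvg_fst _ _ (nbhs p) (nbhs q) _)).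
    exact: (chart_fun_cvg aA).
  apply: (cvg_comp _ _ (@cvg_snd _ _ (nbhs p) (nbhs q) _)).
  exact: (chart_fun_cvg aB).
- move=> [i j] _ /set_mem [[p q] [/= ip jq] <-]; apply: cvg_pair => /=.
    apply: (cvg_comp _ _ (@cvg_fst _ _ (nbhs _) (nbhs _) _)).
    by rewrite (chart_funK aA ip); exact: (chart_inv_cvg aA).
  apply: (cvg_comp _ _ (@cvg_snd _ _ (nbhs _) (nbhs _) _)).
  by rewrite (chart_funK aB jq); exact: (chart_inv_cvg aB).
- move=> [i j] [i' j'] /=.
  have -> : (ch_dom i `*` ch_dom j) `&` (ch_dom i' `*` ch_dom j') =
      (ch_dom i `&` ch_dom i') `*` (ch_dom j `&` ch_dom j').
    by rewrite setXI.
  rewrite imgX; split.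
    by apply: open_setX; [exact: (ch_smooth aA i i').1|exact: (ch_smooth aB j j').1].
  move=> k; apply: Ck_local => -[_ _] [/= [p [ip i'p] <-] [q [jq j'q] <-]].
  apply: (@Ck_at_pair _ _ _ _ _ (fun u => ch_fun i' (ch_inv i u.1))
    (fun u => ch_fun j' (ch_inv j u.2)) _ hE hF).
    apply: (@Ck_at_linear_comp _ _ _ _ _ fst (ch_fun i' \o ch_inv i)) => //.
      by move=> u; exact: cvg_fst.
    exact: (Ck_at_transition aA).
  apply: (@Ck_at_linear_comp _ _ _ _ _ snd (ch_fun j' \o ch_inv j)) => //.
    by move=> u; exact: cvg_snd.
  exact: (Ck_at_transition aB).
Qed.

Lemma model_is_atlas : is_atlas (model_charted E).
Proof.
have img_id (i : ch_idx (model_charted E)) (S : set E) : ch_fun i @` S = S.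
  exact: image_id.
split => //.
- by move=> i; exact: openT.
- by move=> i; rewrite img_id; exact: openT.
- by move=> i p _; exact: cvg_id.
- by move=> i p _; exact: cvg_id.
- move=> i j; rewrite img_id setIT; split; first exact: openT.
  move=> k; apply: Ck_local => u _.
  apply: (@Ck_at_congr _ _ _ _ (fun x => x + 0)); first by near=> x; rewrite addr0.
  by apply: (@Ck_at_affine _ k _ _ id) => // x; exact: cvg_id.
Unshelve. all: by end_near. Qed.

(** * Tangent maps *)

Lemma tangent_map_comp k l (f : M -> N) (g : N -> P) p v :
  Ck_map_at A B k.+1 f p -> Ck_map_at B C l.+1 g (f p) ->
  tangent_map A C (g \o f) (p, v) = tangent_map B C g (tangent_map A B f (p, v)).
Proof.
move=> [cf ckf] [cg ckg]; rewrite /tangent_map /=; congr (_, _).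
have ip := ch_atP aA p; have jp := ch_atP aB (f p).
rewrite -(dirder_near v (near_chart_comp g (ch_at C (g (f p))) ip jp cf)).
have ckg' : Ck_at l.+1 (ch_fun (ch_at C (g (f p))) \o g \o ch_inv (ch_at B (f p)))
    ((ch_fun (ch_at B (f p)) \o f \o ch_inv (ch_at A p)) (ch_fun (ch_at A p) p)).
  by rewrite /= (chart_funK aA).
by rewrite (dirder_comp v hG ckf ckg') /= (chart_funK aA).
Qed.

Lemma tangent_map_near (f g : M -> N) p v : (\forall q \near p, f q = g q) ->
  tangent_map A B f (p, v) = tangent_map A B g (p, v).
Proof.
move=> fg; rewrite /tangent_map /= (nbhs_singleton fg); congr (_, _).
apply: dirder_near.
by apply: filterS (near_chart_inv aA (ch_atP aA p) fg) => u /= ->.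
Qed.

(** This is the chain rule for the transition from the preferred chart at p to the
    chart i, since [tangent_coord] is the differential of that transition. *)
Lemma dirder_chart k (h : M -> F) p (i : ch_idx A) v : ch_dom i p ->
  Ck_at k.+1 (h \o ch_inv i) (ch_fun i p) ->
  dirder (h \o ch_inv (ch_at A p)) (ch_fun (ch_at A p) p) v =
  dirder (h \o ch_inv i) (ch_fun i p) (tangent_coord i (p, v)).
Proof.
move=> ip ch; have i'p := ch_atP aA p.
have ct := Ck_at_transition aA 1 i'p ip.
have ch' : Ck_at k.+1 (h \o ch_inv i)
    ((ch_fun i \o ch_inv (ch_at A p)) (ch_fun (ch_at A p) p)).
  by rewrite /= (chart_funK aA).
have hpsi : \forall u \near ch_fun (ch_at A p) p, (h \o ch_inv (ch_at A p)) u =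
    ((h \o ch_inv i) \o (ch_fun i \o ch_inv (ch_at A p))) u.
  apply: filterS (near_chart_inv aA i'p (chart_dom_near aA ip)) => u iu /=.
  by rewrite (chart_funK aA).
by rewrite (dirder_near v hpsi) (dirder_comp v hF ct ch') /= (chart_funK aA).
Qed.

Lemma tangent_coord_map k (f : M -> N) p v (j : ch_idx B) :
  ch_dom j (f p) -> Ck_map_at A B k.+1 f p ->
  tangent_coord j (tangent_map A B f (p, v)) =
  dirder (ch_fun j \o f \o ch_inv (ch_at A p)) (ch_fun (ch_at A p) p) v.
Proof.
move=> jfp [cf ck]; have ip := ch_atP aA p; have j'fp := ch_atP aB (f p).
rewrite /tangent_coord /tangent_map /=.
have n1 : \forall u \near ch_fun (ch_at A p) p,
    (ch_fun j \o f \o ch_inv (ch_at A p)) u =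
    ((ch_fun j \o ch_inv (ch_at B (f p))) \o
      (ch_fun (ch_at B (f p)) \o f \o ch_inv (ch_at A p))) u.
  have := near_continuous cf (chart_dom_near aB j'fp).
  move=> /(near_chart_inv aA ip); apply: filterS => u /= ju.
  by rewrite (chart_funK aB).
have ct : Ck_at 1 (ch_fun j \o ch_inv (ch_at B (f p)))
    ((ch_fun (ch_at B (f p)) \o f \o ch_inv (ch_at A p)) (ch_fun (ch_at A p) p)).
  by rewrite /= (chart_funK aA ip); exact: Ck_at_transition.
by rewrite (dirder_near v n1) (dirder_comp v hF ck ct) /= (chart_funK aA).
Qed.

Lemma tangent_coord_at p v : tangent_coord (ch_at A p) (p, v) = v.
Proof.
rewrite /tangent_coord /=.
rewrite (@dirder_near _ _ _ _ id); last first.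
  by apply: filterS (chart_inv_near aA (ch_atP aA p)) => u [].
apply: dirderE => //.
have := @cvg_rate_linear R E v; apply: cvg_congr_near; near=> h.
by rewrite /diff_quotient /= [_ + h *: v]addrC addrK subr0.
Unshelve. all: by end_near. Qed.

Lemma tangent_map_linear k (f : M -> N) p : Ck_map_at A B k.+1 f p ->
  linear (fun v => (tangent_map A B f (p, v)).2).
Proof. by move=> [_ cf]; exact: (dirder_linear hF cf). Qed.

Lemma tangent_map_continuous k (f : M -> N) p : Ck_map_at A B k.+1 f p ->
  continuous (fun v => (tangent_map A B f (p, v)).2).
Proof.
move=> [_ cf] v.
have cp : (fun w : E => (ch_fun (ch_at A p) p, w)) @ v --> (ch_fun (ch_at A p) p, v).
  by apply: cvg_pair; [exact: cvg_cst|exact: cvg_id].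
exact: (cvg_comp _ _ cp (Ck_at_continuous (Ck_at_dirder v cf))).
Qed.

End CkMapConstructions.

(** * Local flows *)

Section LocalFlow.
Variables (R : realType) (E : tvsType R) (M : topologicalType) (A : charted E M).
Hypotheses (aA : is_atlas A) (hE : hausdorff_space E).
Variables (D : set (R^o * M)) (Phi : R^o * M -> M).
Hypothesis flowPhi : is_local_flow A D Phi.

Local Notation timeA := (prod_charted (model_charted R^o) A).

Lemma hausdorff_line : hausdorff_space R^o.
Proof. exact: Rhausdorff. Qed.

Lemma hausdorff_time_model : hausdorff_space (R^o * E)%type.
Proof. exact: hausdorff_prod hausdorff_line hE. Qed.

Lemma time_atlas : is_atlas timeA.
Proof.
exact: prod_is_atlas (model_is_atlas hausdorff_line) aA hausdorff_line hE.
Qed.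

Lemma flow_Ck_map_at k sp : D sp -> Ck_map_at timeA A k Phi sp.
Proof.
exact: (smooth_on_Ck_map_at time_atlas aA k (flow_smooth flowPhi)).
Qed.

Lemma flow_cvg sp : D sp -> Phi @ sp --> Phi sp.
Proof. by move=> /(flow_Ck_map_at 0) []. Qed.

Lemma flow_dom_near sp : D sp -> \forall q \near sp, D q.
Proof. by move=> Dsp; apply: open_nbhs_nbhs; split => //; exact: flow_open flowPhi. Qed.

Lemma flow_dom_near_point (s : R) p : D (s, p) -> \forall q \near p, D (s, q).
Proof.
move=> Ds.
have c : (fun q : M => ((s : R^o), q)) @ p --> ((s, p) : (R^o * M)%type).
  by apply: (@cvg_pair_point _ R^o M); [exact: cvg_cst|exact: cvg_id].
exact: (c _ (flow_dom_near Ds)).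
Qed.

Lemma flow_dom_near_time (s : R) p :
  D (s, p) -> \forall h \near (0 : R), D (s + h, p).
Proof.
move=> Ds.
have c : (fun h : R^o => (s + h, p)) @ (0 : R^o) --> ((s + 0, p) : (R^o * M)%type).
  apply: (@cvg_pair_point _ R^o M); last exact: cvg_cst.
  by apply: (@tvs_cvgD _ _ _ _ _ (fun=> (s : R^o)) id); [exact: cvg_cst|exact: cvg_id].
rewrite addr0 in c; exact: (c _ (flow_dom_near Ds)).
Qed.

Lemma flow_near_time0 (y : M) : \forall h \near (0 : R), D (h, y).
Proof.
by apply: filterS (flow_dom_near_time (flow_dom0 flowPhi y)) => h; rewrite add0r.
Qed.

Lemma flow_dom_between (x y z : R) p : D (x, p) -> D (y, p) -> x <= z <= y -> D (z, p).
Proof. by move=> Dx Dy; exact: (@flow_itv _ _ _ _ _ _ flowPhi p x y Dx Dy z). Qed.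

Lemma flow_dom_ge0 (y z : R) p : D (y, p) -> 0 <= z <= y -> D (z, p).
Proof. by move=> Dy; exact: flow_dom_between (flow_dom0 flowPhi p) Dy. Qed.

Lemma flow_dom_le0 (x z : R) p : D (x, p) -> x <= z <= 0 -> D (z, p).
Proof. by move=> Dx; exact: flow_dom_between Dx (flow_dom0 flowPhi p). Qed.

Lemma flow_dom_scale (t u : R) p : D (t, p) -> 0 <= u <= 1 -> D (u * t, p).
Proof.
move=> Dt /andP[u0 u1]; have [t0|/ltW t0] := leP 0 t.
  by apply: (flow_dom_ge0 Dt); apply/andP; split; nra.
by apply: (flow_dom_le0 Dt); apply/andP; split; nra.
Qed.

Lemma flow_add (s t r : R) p : D (s, p) -> D (t, Phi (s, p)) -> D (r, p) -> t + s = r ->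
  Phi (t, Phi (s, p)) = Phi (r, p).
Proof.
by move=> Ds Dt Dr tsr; rewrite -tsr; apply: (flowD flowPhi) => //; rewrite tsr.
Qed.

Lemma cvg_flow_curve (s : R) (y : M) : D (s, y) ->
  (fun h : R^o => Phi (h, y)) @ (s : R^o) --> Phi (s, y).
Proof.
move=> Dy; apply: (cvg_comp _ _ _ (flow_cvg Dy)).
by apply: (@cvg_pair_point _ R^o M); [exact: cvg_id|exact: cvg_cst].
Qed.

Lemma near_flow_back (y : M) :
  \forall h \near (0 : R), D (- h, Phi (h, y)) /\ Phi (- h, Phi (h, y)) = y.
Proof.
have c : (fun h : R^o => (- h, Phi (h, y))) @ (0 : R^o)
    --> ((- 0, Phi (0, y)) : (R^o * M)%type).
  apply: (@cvg_pair_point _ R^o M); last exact: (cvg_flow_curve (flow_dom0 flowPhi y)).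
  by apply: (@tvs_cvgN _ _ _ _ _ id); exact: cvg_id.
have D0 : D (- 0, Phi (0, y)).
  by rewrite oppr0 (flow0 flowPhi); exact: flow_dom0 flowPhi y.
have n1 := @near_continuous _ _ (fun h : R^o => (- h, Phi (h, y))) 0 D c
  (flow_dom_near D0).
apply: filterS2 n1 (flow_near_time0 y) => h Dh Dhy; split => //.
rewrite (@flow_add _ _ 0) ?(flow0 flowPhi)//; last by rewrite addNr.
exact: flow_dom0 flowPhi y.
Qed.

Lemma flow_map_Ck_map_at k (s : R) p :
  D (s, p) -> Ck_map_at A A k (fun q => Phi (s, q)) p.
Proof.
move=> Ds; apply: (Ck_map_at_comp (B := prod_charted (model_charted R^o) A)
  (f := fun q => ((s : R^o), q)) (g := Phi) aA time_atlas
  hausdorff_time_model hE); last exact: (flow_Ck_map_at k Ds).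
have hR := hausdorff_line.
by apply: (Ck_map_at_pair hR hE); [exact: (Ck_map_at_cst _ _ hR)|exact: Ck_map_at_id].
Qed.

Lemma flow_curve_Ck_map_at k (s : R) p : D (s, p) ->
  Ck_map_at (model_charted R^o) A k (fun r => Phi (r, p)) (s : R^o).
Proof.
move=> Ds; have hR := hausdorff_line; have aR := model_is_atlas hR.
apply: (Ck_map_at_comp (B := prod_charted (model_charted R^o) A)
  (f := fun r => ((r : R^o), p)) (g := Phi) aR time_atlas
  hausdorff_time_model hE); last exact: (flow_Ck_map_at k Ds).
by apply: (Ck_map_at_pair hR hE); [exact: (Ck_map_at_id aR hR)|exact: Ck_map_at_cst].
Qed.

Lemma local_velocity (X : M -> E) (k : ch_idx A) p :
  local_flow_of A X D Phi -> ch_dom k p ->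
  dirder (fun u : R^o * E => ch_fun k (Phi (u.1, ch_inv k u.2))) (0, ch_fun k p) (1, 0) =
  vf_local k X (ch_fun k p).
Proof.
move=> [_ vel] kp; rewrite /vf_local (chart_funK aA kp) -vel.
have k0p : ch_dom k (Phi (0, p)) by rewrite (flow0 flowPhi).
rewrite (tangent_coord_map (model_is_atlas hausdorff_line) aA hE _ k0p
  (flow_curve_Ck_map_at 1 (flow_dom0 flowPhi p))).
apply: dirder_quotient => h.
by rewrite /diff_quotient !pairDZ /= !scaler0 addr0 (chart_funK aA kp).
Qed.

(** * Maximal flows *)

Definition extension_dom : set (R^o * M) :=
  [set sp | exists a : R, D (a, sp.2) /\ D (sp.1 - a, Phi (a, sp.2))].

(** On [extension_dom] there is an intermediate time to choose, and by
    [two_step_flow_unique] all intermediate times give the same point. *)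
Definition extension_flow (sp : R^o * M) : M :=
  let a := xget 0 [set a : R | D (a, sp.2) /\ D (sp.1 - a, Phi (a, sp.2))] in
  Phi (sp.1 - a, Phi (a, sp.2)).

(** The three cases are the positions of s relative to the intermediate times
    a <= b.  In each of them the flow law relates both sides within D, because the
    times of existence at a given point form an interval. *)
Lemma two_step_flow_unique (a b s : R) p :
  D (a, p) -> D (s - a, Phi (a, p)) -> D (b, p) -> D (s - b, Phi (b, p)) ->
  Phi (s - a, Phi (a, p)) = Phi (s - b, Phi (b, p)).
Proof.
wlog ab : a b / a <= b.
  by move=> H Da Dsa Db Dsb; case/orP: (le_total a b) => ab; [|symmetry]; exact: H.
move=> Da Dsa Db Dsb.
have [sa|lt_as] := leP s a.
  have Dab : D (a - b, Phi (b, p)).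
    by apply: flow_dom_le0 Dsb _; apply/andP; split; lra.
  have eqa : Phi (a - b, Phi (b, p)) = Phi (a, p) by apply: flow_add => //; lra.
  by rewrite -eqa; apply: flow_add => //; rewrite ?eqa//; lra.
have [sb|lt_bs] := leP s b.
  have Ds : D (s, p) by apply: flow_dom_between Da Db _; rewrite (ltW lt_as) sb.
  by rewrite !(@flow_add _ _ s)//; lra.
have Dba : D (b - a, Phi (a, p)).
  by apply: flow_dom_ge0 Dsa _; apply/andP; split; lra.
have eqb : Phi (b - a, Phi (a, p)) = Phi (b, p) by apply: flow_add => //; lra.
by rewrite -eqb; symmetry; apply: flow_add => //; rewrite ?eqb//; lra.
Qed.

Lemma extension_flowE (a s : R) p : D (a, p) -> D (s - a, Phi (a, p)) ->
  extension_flow (s, p) = Phi (s - a, Phi (a, p)).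
Proof.
move=> Da Dsa; rewrite /extension_flow /=.
set S := [set b : R | _].
have [Db Dsb] : S (xget 0 S) by apply: (@xgetPex _ 0 S); exists a.
exact: two_step_flow_unique.
Qed.

Lemma extension_dom_base s p : D (s, p) -> extension_dom (s, p).
Proof.
move=> Ds; exists s; rewrite /= subrr; split => //; exact: flow_dom0 flowPhi _.
Qed.

Lemma extension_flow_base s p : D (s, p) -> extension_flow (s, p) = Phi (s, p).
Proof.
move=> Ds; rewrite (@extension_flowE s)// subrr ?(flow0 flowPhi)//.
exact: flow_dom0 flowPhi _.
Qed.

Lemma extension_dom_scale (s r : R) p : extension_dom (s, p) ->
  0 <= r <= s \/ s <= r <= 0 -> extension_dom (r, p).
Proof.
move=> [a [/= Da Dsa]] [/andP[r0 rs]|/andP[sr r0]].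
- have [ra|lt_ar] := leP r a.
    by apply: extension_dom_base; apply: flow_dom_ge0 Da _; rewrite r0.
  exists a; split => //=; apply: flow_dom_ge0 Dsa _; apply/andP; split; lra.
- have [ar|lt_ra] := leP a r.
    by apply: extension_dom_base; apply: flow_dom_le0 Da _; rewrite ar.
  exists a; split => //=; apply: flow_dom_le0 Dsa _; apply/andP; split; lra.
Qed.

Lemma extension_itv p : is_interval [set t : R | extension_dom (t, p)].
Proof.
move=> x y /= Dx Dy z /andP[xz zy].
have [z0|z0] := leP 0 z.
  by apply: extension_dom_scale Dy _; left; rewrite z0.
by apply: extension_dom_scale Dx _; right; rewrite xz ltW.
Qed.

Lemma first_step_Ck_map_at k (a s : R) p : D (a, p) ->
  Ck_map_at timeA timeA k (fun sp => (sp.1 - a, Phi (a, sp.2))) (s, p).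
Proof.
move=> Da.
have aR := model_is_atlas hausdorff_line.
have hR := hausdorff_line; have aRA := time_atlas; have hRA := hausdorff_time_model.
apply: Ck_map_at_pair => //.
  apply: (Ck_map_at_comp (B := model_charted R^o) (f := fst)
    (g := fun x : R^o => x - a) aRA aR hR hR); first exact: Ck_map_at_fst.
  exact: Ck_map_at_translation.
apply: (Ck_map_at_comp (B := timeA) (f := fun sp : R^o * M => (a, sp.2))
  aRA aRA hRA hE); last exact: flow_Ck_map_at.
apply: Ck_map_at_pair => //; [exact: Ck_map_at_cst|exact: Ck_map_at_snd].
Qed.

Lemma two_step_near (a s : R) p : D (a, p) -> D (s - a, Phi (a, p)) ->
  \forall sp \near (s, p), D (a, sp.2) /\ D (sp.1 - a, Phi (a, sp.2)).
Proof.
move=> Da Dsa.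
have n1 : \forall sp \near ((s : R^o), p), D (a, sp.2).
  exact: (@near_snd _ _ (s : R^o) p (fun q => D (a, q)) (flow_dom_near_point Da)).
have n2 := near_continuous (first_step_Ck_map_at 0 s Da).1 (flow_dom_near Dsa).
by apply: filterS2 n1 n2.
Qed.

Lemma extension_dom_near sp : extension_dom sp -> \forall q \near sp, extension_dom q.
Proof.
case: sp => s p [a [/= Da Dsa]]; apply: filterS (two_step_near Da Dsa) => -[r q] Dq.
by exists a.
Qed.

(** The intermediate time a of a point also serves for the points nearby, so that
    the extension is locally a composition of two flow maps. *)
Lemma extension_Ck_map_at k sp :
  extension_dom sp -> Ck_map_at timeA A k extension_flow sp.
Proof.
case: sp => s p [a [/= Da Dsa]].
have aRA := time_atlas; have hRA := hausdorff_time_model.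
apply: (Ck_map_at_congr (f := Phi \o (fun sp => (sp.1 - a, Phi (a, sp.2)))) aRA).
  apply: filterS (two_step_near Da Dsa) => -[r q] [/= Dq Drq].
  by rewrite (extension_flowE Dq Drq).
apply: (Ck_map_at_comp (B := timeA) aRA aRA hRA hE).
  exact: first_step_Ck_map_at.
exact: flow_Ck_map_at.
Qed.

(** Integral curves at constant speed t, but without derivatives: near each time the
    curve is a piece of a flow line.  The second equation, the step back, is what makes
    such a curve unique. *)
Definition follows_flow (t : R) (gamma : R -> M) : Prop :=
  forall s : R, 0 <= s <= 1 -> \forall r \near s,
    gamma r = Phi ((r - s) * t, gamma s) /\ gamma s = Phi (- ((r - s) * t), gamma r).

(** On a short interval [a, b] around s, the value at a determines the value at s by
    the inverse step, which in turn determines the value at b. *)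
Lemma follows_flow_unique t gamma delta : follows_flow t gamma -> follows_flow t delta ->
  gamma 0 = delta 0 -> gamma 1 = delta 1.
Proof.
move=> fg fd.
apply: (@cousin_induction R (fun a b => gamma a = delta a -> gamma b = delta b)).
  by move=> a b c _ _ ab bc /ab /bc.
move=> s s01; exists [set r | (gamma r = Phi ((r - s) * t, gamma s) /\
    gamma s = Phi (- ((r - s) * t), gamma r)) /\
    (delta r = Phi ((r - s) * t, delta s) /\
    delta s = Phi (- ((r - s) * t), delta r))].
  by apply: filterI; [exact: fg|exact: fd].
move=> a b /= [[ga ga'] [da da']] [[gb gb'] [db db']] _ _ eqa.
by rewrite gb db ga' da' eqa.
Qed.

Lemma extension_near_step (r : R) p : extension_dom (r, p) ->
  \forall h \near (0 : R), extension_flow (r + h, p) = Phi (h, extension_flow (r, p)).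
Proof.
move=> [a [/= Da Dra]].
have eqr := extension_flowE Da Dra.
apply: filterS2 (flow_dom_near_time Dra) (flow_near_time0 (extension_flow (r, p))) => h.
rewrite addrAC => Dh Dh'.
rewrite (extension_flowE Da Dh) eqr; symmetry.
by apply: flow_add => //; [rewrite -eqr|lra].
Qed.

Lemma extension_follows_flow (r t : R) p :
  (forall s, 0 <= s <= 1 -> extension_dom (r + s * t, p)) ->
  follows_flow t (fun s => extension_flow (r + s * t, p)).
Proof.
move=> dom s s01; have /extension_near_step /(near_speed s t) n1 := dom s s01.
have := near_speed s t (near_flow_back (extension_flow (r + s * t, p))).
apply: filterS2 n1 => q.
have -> : r + s * t + (q - s) * t = r + q * t by ring.
by move=> -> [_ ->].
Qed.

(** Both sides are the end points of curves that start at the same point and follow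
    the flow at speed t. *)
Lemma extension_flow_add (s t : R) p :
  extension_dom (s, p) -> extension_dom (t, extension_flow (s, p)) ->
  extension_dom (t + s, p) ->
  extension_flow (t, extension_flow (s, p)) = extension_flow (t + s, p).
Proof.
move=> Ds Dt Dts; set q := extension_flow (s, p) in Dt *.
have := @follows_flow_unique t (fun u => extension_flow (0 + u * t, q))
  (fun u => extension_flow (s + u * t, p)).
rewrite !mul0r !mul1r !addr0 add0r [s + t]addrC; apply.
- apply: extension_follows_flow => u /andP[u0 u1]; rewrite add0r.
  apply: extension_dom_scale Dt _.
  have [t0|/ltW t0] := leP 0 t; [left|right]; apply/andP; split; nra.
- apply: extension_follows_flow => u /andP[u0 u1].
  have [t0|/ltW t0] := leP 0 t.
    by apply: (extension_itv Ds Dts); apply/andP; split; nra.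
  by apply: (extension_itv Dts Ds); apply/andP; split; nra.
- by rewrite (extension_flow_base (flow_dom0 flowPhi q)) (flow0 flowPhi).
Qed.

Lemma extension_is_local_flow : is_local_flow A extension_dom extension_flow.
Proof.
split.
- by rewrite openE => sp; exact: extension_dom_near.
- by move=> m; exact/extension_dom_base/(flow_dom0 flowPhi).
- exact: extension_itv.
- apply: Ck_map_at_smooth_on.
  + exact: time_atlas.
  + exact: aA.
  + exact: hausdorff_time_model.
  + exact: hE.
  + by rewrite openE => sp; exact: extension_dom_near.
  + by move=> k sp; exact: extension_Ck_map_at.
- move=> m; rewrite (extension_flow_base (flow_dom0 flowPhi m)).
  exact: flow0 flowPhi m.
- exact: extension_flow_add.
Qed.

Lemma extension_velocity (X : M -> E) : local_flow_of A X D Phi ->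
  local_flow_of A X extension_dom extension_flow.
Proof.
move=> [_ vel]; split; first exact: extension_is_local_flow.
move=> m; rewrite -vel; apply: tangent_map_near.
  exact: model_is_atlas hausdorff_line.
by apply: filterS (flow_near_time0 m) => h /extension_flow_base.
Qed.

End LocalFlow.

Section MaximalFlow.
Variables (R : realType) (E : tvsType R) (M : topologicalType) (A : charted E M).
Hypotheses (aA : is_atlas A) (hE : hausdorff_space E).
Variables (X : M -> E) (D : set (R^o * M)) (Phi : R^o * M -> M).
Hypothesis maxPhi : maximal_local_flow_of A X D Phi.

Let flowPhi : is_local_flow A D Phi := maxPhi.1.1.

(** The two-step extension of a maximal flow is a local flow with the same velocity
    field, hence contained in it. *)
Lemma maximal_flow_dom_add (a s : R) p : D (a, p) -> D (s - a, Phi (a, p)) -> D (s, p).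
Proof.
move=> Da Dsa.
have [sub _] := maxPhi.2 _ _ (extension_velocity aA hE flowPhi maxPhi.1).
by apply: sub; exists a.
Qed.

(** Along the flow line of p, being able to flow back to p propagates from a time a to
    a slightly later time b: flow back from b to a, then from a to 0. *)
Lemma maximal_flow_dom_inv (t : R) p : D (t, p) -> D (- t, Phi (t, p)).
Proof.
move=> Dt.
have Dut u := flow_dom_scale flowPhi (u := u) Dt.
pose Q u := D (- (u * t), Phi (u * t, p)).
suff : Q 0 -> Q 1.
  rewrite /Q mul0r mul1r oppr0; apply.
  by rewrite (flow0 flowPhi); exact: flow_dom0 flowPhi p.
apply: (@cousin_induction R (fun a b => Q a -> Q b)).
  by move=> a b c _ _ ab bc /ab /bc.
move=> s s01; have Ds := Dut s s01.
have c1 : (fun ab : R * R => ((ab.1 - ab.2) * t : R^o)) @ (s, s) --> (0 : R^o).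
  rewrite -[X in _ --> X](mul0r t) -(subrr s).
  apply: cvgM; last exact: cvg_cst.
  by apply: cvgB; [exact: cvg_fst|exact: cvg_snd].
have c2 : (fun ab : R * R => Phi (ab.2 * t, p)) @ (s, s) --> Phi (s * t, p).
  have c3 : (fun ab : R * R => (ab.2 * t : R^o)) @ (s, s) --> (s * t : R^o).
    by apply: cvgM; [exact: cvg_snd|exact: cvg_cst].
  exact: (cvg_comp _ _ c3 (cvg_flow_curve aA hE flowPhi Ds)).
have D0 := flow_dom_near flowPhi (flow_dom0 flowPhi (Phi (s * t, p))).
have [[B C] /= [nB nC] BC] := cvg_pair_point c1 c2 D0.
exists (B `&` C); first exact: filterI.
move=> a b [Ba _] [_ Cb] /andP[a0 as_] /andP[sb b1] Qa.
have Da : D (a * t, p) by apply: Dut; rewrite a0; move/andP: s01 => [_ s1]; lra.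
have Db : D (b * t, p) by apply: Dut; rewrite b1 andbT; move/andP: s01 => [s0 _]; lra.
have Dab : D ((a - b) * t, Phi (b * t, p)) by exact: (BC (a, b) (conj Ba Cb)).
apply: (maximal_flow_dom_add (a := (a - b) * t)) => //.
have -> : Phi ((a - b) * t, Phi (b * t, p)) = Phi (a * t, p).
  by apply: (flow_add flowPhi) => //; ring.
by have -> : - (b * t) - (a - b) * t = - (a * t) by ring.
Qed.

End MaximalFlow.

(** * Pushforward of vector fields along a flow *)

Section GlobalFlow.
Variables (R : realType) (E : tvsType R) (hE : hausdorff_space E).
Variables (X : E -> E) (Psi : R^o * E -> E).
Hypothesis flowPsi : global_flow_of (model_charted E) X Psi.

Lemma global_flow_rate (s : R) z :
  (fun h => h^-1 *: (Psi (s + h, z) - Psi (s, z))) @ 0^' --> X (Psi (s, z)).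
Proof.
have [isflow vel] := flowPsi; have aE := model_is_atlas hE.
pose w := Psi (s, z).
have [_ cw] := flow_curve_Ck_map_at aE hE isflow 1 (flow_dom0 isflow w).
have := Ck_at_dirderivable (v := (1 : R^o)) cw.
have -> : dirder (ch_fun (ch_at (model_charted E) (Psi (0, w))) \o
    (fun r : R^o => Psi (r, w)) \o ch_inv (ch_at (model_charted R^o) 0))
    (ch_fun (ch_at (model_charted R^o) 0) 0) 1 = X w by have [] := vel w.
apply: cvg_congr_near; near=> h.
rewrite /diff_quotient /= add0r [h *: 1]mulr1 (flow0 isflow) (flowD isflow)//.
by rewrite [s + h]addrC.
Unshelve. all: by end_near. Qed.

Lemma global_flow_reversed_rate (s : R) z :
  (fun h => h^-1 *: (Psi (s - h, z) - Psi (s, z))) @ 0^' --> - X (Psi (s, z)).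
Proof.
have c : (fun h : R => h * (- 1)) @ (0 : R)^' --> (0 : R)^'.
  by apply: cvg_dnbhs0M; rewrite oppr_eq0 oner_eq0.
have : (fun h => - ((h * - 1)^-1 *: (Psi (s + h * - 1, z) - Psi (s, z))))
    @ (0 : R)^' --> - X (Psi (s, z)).
  by apply: tvs_cvgN; exact: (cvg_comp _ _ c (@global_flow_rate s z)).
apply: cvg_congr_near; near=> h.
by rewrite /= mulrN1 invrN scaleNr opprK.
Unshelve. all: by end_near. Qed.

End GlobalFlow.

Section InfinitesimalPushforward.
Variables (R : realType) (g : lcLieAlgebra R) (E : tvsType R) (M : topologicalType).
Variables (A : charted E M) (aA : is_atlas A) (hE : hausdorff_space E).
Variables (beta : g -> M -> E) (hbeta : lie_hom A beta).
Hypothesis hsmooth : smooth_on (prod_charted (model_charted g) A)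
                       (tangent_charted A) setT (hat beta).
Variables (x : g) (D : set (R^o * M)) (Phi : R^o * M -> M).
Hypothesis flowPhi : local_flow_of A (beta x) D Phi.

Let isflow : is_local_flow A D Phi := flowPhi.1.

Definition hat_local (k : ch_idx A) (zu : g * E) : E := vf_local k (beta zu.1) zu.2.

Lemma hat_local_Ck_at n (k : ch_idx A) z q : ch_dom k q ->
  Ck_at n (hat_local k) (z, ch_fun k q).
Proof.
move=> kq; have [] := hsmooth (tt, k) k.
set U := _ @` _ => oU cU.
have Uzq : U (z, ch_fun k q) by exists (z, q).
have crep : Ck_at n (ch_fun (k : ch_idx (tangent_charted A)) \o hat beta \o
    @ch_inv _ _ _ (prod_charted (model_charted g) A) (tt, k)) (z, ch_fun k q).
  by exists U.
have -> : hat_local k = (fun v : E * E => v.2 + 0) \o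
   (ch_fun (k : ch_idx (tangent_charted A)) \o hat beta \o
    @ch_inv _ _ _ (prod_charted (model_charted g) A) (tt, k)).
  by apply/funext => -[z' u'] /=; rewrite addr0.
apply: Ck_at_comp crep _ => //; first exact: hausdorff_prod.
apply: (Ck_at_affine n 0 _ hE) => // u; exact: cvg_snd.
Qed.

Lemma hat_local_at q z : hat_local (ch_at A q) (z, ch_fun (ch_at A q) q) = beta z q.
Proof.
rewrite /hat_local /vf_local /= (chart_funK aA (ch_atP aA q)).
exact: tangent_coord_at.
Qed.

Lemma beta_linear q : linear (fun z => beta z q).
Proof. by move=> a z z'; exact: (hom_linear hbeta). Qed.

(** In the chart at q, [pushforward_derivative] applies to the coordinates b h of
    beta (zeta h) along the flow line, whose rate is given by [bilinear_derivative]
    for the map (z, u) |-> beta z u.  The three terms that result cancel because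
    beta respects brackets. *)
Lemma pushforward_rate (t : R) (q : M) (zeta : R -> g) :
  (fun h => h^-1 *: (zeta h - zeta 0)) @ 0^' --> - (t *: lie_br x (zeta 0)) ->
  (fun h => h^-1 *: ((tangent_map A A (fun p => Phi (- (h * t), p))
      (section (beta (zeta h)) (Phi (h * t, q)))).2 - beta (zeta 0) q)) @ 0^' --> (0 : E).
Proof.
move=> dzeta.
pose k := ch_at A q; pose u0 := ch_fun k q.
have kq : ch_dom k q := ch_atP aA q.
have invu0 : ch_inv k u0 = q by exact: chart_funK.
pose phi (u : R^o * E) := ch_fun k (Phi (u.1, ch_inv k u.2)).
have k0q : ch_dom k (Phi (0, q)) by rewrite (flow0 isflow).
have cphi : Ck_at 2 phi (0, u0).
  have ikq : @ch_dom _ _ _ (prod_charted (model_charted R^o) A) (tt, k) (0, q) by [].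
  have := flow_Ck_map_at aA hE isflow 2 (flow_dom0 isflow q).
  move=> /(Ck_map_atP (time_atlas aA hE) aA (hausdorff_time_model hE) hE 2 ikq k0q).
  by move=> [_].
have cphi1 := Ck_at1 cphi.
have phi0 : \forall u \near u0, phi (0, u) = u.
  by apply: filterS (chart_inv_near aA kq) => u [_]; rewrite /phi /= (flow0 isflow).
have velocity : \forall u \near u0, dirder phi (0, u) (1, 0) = hat_local k (x, u).
  apply: filterS (chart_inv_near aA kq) => u [ku fu].
  by have := local_velocity aA hE isflow flowPhi ku; rewrite fu.
pose X u := hat_local k (x, u); pose Y u := hat_local k (zeta 0, u).
have Yu0 : Y u0 = beta (zeta 0) q by exact: hat_local_at.
pose u h := phi (h * t, u0).
have u0E : u 0 = u0 by rewrite /u mul0r; exact: nbhs_singleton phi0.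
have du : (fun h => h^-1 *: (u h - u 0)) @ 0^' --> t *: X u0.
  rewrite u0E /X -(nbhs_singleton velocity).
  by apply: local_flow_rate => //; exact: nbhs_singleton phi0.
pose b h := hat_local k (zeta h, u h).
have b0E : b 0 = Y u0 by rewrite /b u0E.
have lB : linear (fun z => hat_local k (z, u 0)).
  rewrite u0E; have -> : (fun z => hat_local k (z, u0)) = (fun z => beta z q).
    by apply/funext => z; exact: hat_local_at.
  exact: beta_linear.
have cB : Ck_at 1 (hat_local k) (zeta 0, u 0) by rewrite u0E; exact: hat_local_Ck_at.
have db := bilinear_derivative hE cB lB dzeta du.
have dYt : dirder Y u0 (t *: X u0) = t *: dirder Y u0 (X u0).
  rewrite !dirder_slice.
  rewrite -(linear_scale _ _ (dirder_linear hE (hat_local_Ck_at 1 (zeta 0) kq))).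
  by congr dirder; apply: injective_projections; rewrite /= ?scaler0.
(* k is the chart in which the bracket of vector fields at q is defined *)
have hom : beta (lie_br x (zeta 0)) q = dirder Y u0 (X u0) - dirder X u0 (Y u0).
  by rewrite (hom_bracket hbeta).
have main := @pushforward_derivative R E phi u0 b _ t hE cphi phi0 db.
have lim0 : hat_local k (- (t *: lie_br x (zeta 0)), u 0) +
    dirder (fun v => hat_local k (zeta 0, v)) (u 0) (t *: X u0) -
    t *: dirder (fun v => dirder phi (0, v) (1, 0)) u0 (b 0) = 0.
  rewrite u0E (hat_local_at q) -scaleNr (linear_scale _ _ (beta_linear q)) hom.
  rewrite -/Y dYt b0E (dirder_near _ velocity) -/X.
  by rewrite scaleNr scalerBr opprB subrK subrr.
have {main}main : (fun h => h^-1 *: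
    (dirder phi (- (h * t), phi (h * t, u0)) (0, b h) - b 0)) @ 0^' --> (0 : E).
  by rewrite -lim0; exact: main.
apply: (cvg_congr_near _ main).
(* for small h the curve stays in the chart k, where the tangent map of
   Phi (- (h * t), _) is a partial differential of phi *)
have nk : \forall h \near (0 : R), ch_dom k (Phi (h, q)).
  have := cvg_flow_curve aA hE isflow (flow_dom0 isflow q).
  by move=> c; exact: (c _ (chart_dom_near aA k0q)).
have := near_dnbhs0_scale t (near_flow_back aA hE isflow q).
apply: filterS2 (near_dnbhs0_scale t nk) => h kh [Dh back].
have uhE : u h = ch_fun k (Phi (h * t, q)) by rewrite /u /phi /= invu0.
rewrite b0E Yu0; congr (_ *: (_ - _)); symmetry.
rewrite /tangent_map /section /= back.
have cf := flow_map_Ck_map_at aA hE isflow 1 Dh.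
have kf : ch_dom k (Phi (- (h * t), Phi (h * t, q))) by rewrite back.
have [_ cf1] := (Ck_map_atP aA aA hE hE 1 kh kf).1 cf.
rewrite (dirder_chart aA hE _ kh cf1).
have -> : tangent_coord k (Phi (h * t, q), beta (zeta h) (Phi (h * t, q))) = b h.
  by rewrite /b /hat_local /vf_local /= uhE (chart_funK aA kh).
rewrite -[phi (h * t, u0)]/(u h) -uhE.
exact: (dirder_slice phi).
Qed.

End InfinitesimalPushforward.

Theorem lemma3p4 (R : realType) (g : lcLieAlgebra R) (hg : ad_integrable g)
  (E : tvsType R) (M : lcManifold E) (beta : g -> M -> E)
  (hbeta : lie_hom (mfd_atlas M) beta)
  (hsmooth : smooth_on (prod_charted (model_charted g) (mfd_atlas M))
                       (tangent_charted (mfd_atlas M)) setT (hat beta))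
  (x : g) (hx : vf_locally_integrable (mfd_atlas M) (beta x))
  (D : set (R^o * M)) (Phi : R^o * M -> M)
  (hPhi : maximal_local_flow_of (mfd_atlas M) (beta x) D Phi)
  (y : g) (t : R) (m : M) (hm : D (t, m)) :
  flow_pushforward (mfd_atlas M) Phi (- t) (beta y) m
  = section (beta (exp_ad (t *: x) y)) m.
Proof.
have aA := mfd_atlasP M; have hE := mfd_model_hausdorff M.
have isflow := hPhi.1.1.
set A := mfd_atlas M in hbeta hsmooth hx hPhi aA isflow *.
have [Psi flowPsi ->] :
    exists2 Psi, global_flow_of (model_charted g) (lie_br (t *: x)) Psi
    & exp_ad (t *: x) y = Psi (1, y).
  have [Psi flowPsi] := hg (t *: x).
  by apply: (@xgetPex _ 0 [set z | exists2 Psi,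
    global_flow_of (model_charted g) (lie_br (t *: x)) Psi & z = Psi (1, y)]);
    exists (Psi (1, y)), Psi.
have hgg := lie_hausdorff (l := g).
have Dut u := flow_dom_scale isflow (u := u) hm.
(* w runs in the fixed tangent space at m, from the right-hand side to the left *)
pose w (u : R^o) : E := (tangent_map A A (fun p => Phi (- (u * t), p))
  (section (beta (Psi (1 - u, y))) (Phi (u * t, m)))).2.
have w0 : w 0 = beta (Psi (1, y)) m.
  rewrite /w mul0r oppr0 addr0 (flow0 isflow) /section.
  rewrite (@tangent_map_near _ _ _ _ _ A A aA _ id); last first.
    by near=> p; exact: flow0 isflow p.
  exact: tangent_coord_at.
have w1 : flow_pushforward A Phi (- t) (beta y) m = (m, w 1).
  rewrite /flow_pushforward /w mul1r opprK subrr (flow0 flowPsi.1).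
  rewrite [LHS]surjective_pairing; congr (_, _) => /=.
  rewrite (@flow_add _ _ _ _ _ _ isflow _ _ 0) ?(flow0 isflow) ?addNr//.
    exact: maximal_flow_dom_inv hPhi _ _ hm.
  exact: flow_dom0 isflow m.
rewrite w1 /section -w0; congr (_, _); symmetry.
apply: (eq_of_zero_derivative hE) => s s01.
(* at time s + h the vector w is the image under L of the vector r h at q *)
pose q := Phi (s * t, m); pose sigma := s * t.
have Ds := Dut s s01.
have Dinv := maximal_flow_dom_inv aA hE hPhi.
have Dq : D (- sigma, q) by exact: Dinv.
pose L v := (tangent_map A A (fun p => Phi (- sigma, p)) (q, v)).2.
have cfsigma := flow_map_Ck_map_at aA hE isflow 1 Dq.
have lL : linear L := tangent_map_linear hE cfsigma.
pose r h := (tangent_map A A (fun p => Phi (- (h * t), p))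
  (section (beta (Psi (1 - (s + h), y))) (Phi (h * t, q)))).2.
have dr : (fun h => h^-1 *: (r h - beta (Psi (1 - s, y)) q)) @ 0^' --> (0 : E).
  pose zeta h := Psi (1 - (s + h), y).
  have zeta0 : zeta 0 = Psi (1 - s, y) by rewrite /zeta addr0.
  have dzeta : (fun h => h^-1 *: (zeta h - zeta 0)) @ 0^' --> - (t *: lie_br x (zeta 0)).
    have := @global_flow_reversed_rate _ _ hgg _ _ flowPsi (1 - s) y.
    rewrite -zeta0 (linear_scale _ _ (@lie_linear_l _ g (zeta 0))).
    by apply: cvg_congr_near; near=> h; rewrite zeta0 /zeta opprD addrA.
  have := pushforward_rate aA hE hbeta hsmooth hPhi.1 q dzeta.
  by rewrite zeta0.
have dL : (fun h => L (h^-1 *: (r h - beta (Psi (1 - s, y)) q))) @ 0^' --> (0 : E).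
  rewrite -(linear_zero lL); apply: (cvg_comp _ _ dr).
  exact: tangent_map_continuous cfsigma _.
apply: (cvg_congr_near _ dL).
have : \forall h \near (0 : R)^', [/\ D (sigma + h * t, m), D (h * t, q),
    D (- (h * t), Phi (h * t, q)) & Phi (- (h * t), Phi (h * t, q)) = q].
  apply: (near_dnbhs0_scale t (P := fun h => [/\ D (sigma + h, m), D (h, q),
    D (- h, Phi (h, q)) & Phi (- h, Phi (h, q)) = q])).
  have nback := near_flow_back aA hE isflow q.
  apply: filterS3 (flow_dom_near_time isflow Ds) (flow_near_time0 isflow q) nback.
  by move=> h ? ? [].
apply: filterS => h [Dsh Dhq Dback back].
have Dsht : D ((s + h) * t, m) by rewrite mulrDl.
set qh := Phi (h * t, q) in Dback back.
have qhE : Phi ((s + h) * t, m) = qh.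
  by symmetry; apply: (flow_add isflow) => //; rewrite mulrDl addrC.
have wshE : w (s + h) = L (r h).
  have Dsh' : D (- ((s + h) * t), qh) by rewrite -qhE; exact: Dinv.
  have Dq' : D (- sigma, Phi (- (h * t), qh)) by rewrite back.
  have cfh := flow_map_Ck_map_at aA hE isflow 1 Dback.
  have cfsigma' := flow_map_Ck_map_at aA hE isflow 1 Dq'.
  have split_flow : \forall p \near qh, Phi (- ((s + h) * t), p) =
      ((fun p => Phi (- sigma, p)) \o (fun p => Phi (- (h * t), p))) p.
    have n1 := near_continuous cfh.1 (flow_dom_near_point isflow Dq').
    have n2 := flow_dom_near_point isflow Dback.
    apply: filterS3 n1 n2 (flow_dom_near_point isflow Dsh') => p Dp Dp1 Dp2 /=.
    by symmetry; apply: (flow_add isflow) => //; rewrite /sigma mulrDl opprD.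
  rewrite /w qhE /section (tangent_map_near A aA _ split_flow).
  rewrite (tangent_map_comp aA aA hE _ cfh cfsigma') /L; congr (tangent_map A A _ _).2.
  by rewrite [LHS]surjective_pairing /r -/qh /= back.
rewrite /diff_quotient [h *: 1]mulr1 wshE (linear_scale _ _ lL); congr (_ *: _).
have -> : w s = L (beta (Psi (1 - s, y)) q) by [].
by have := lL (- 1) (beta (Psi (1 - s, y)) q) (r h); rewrite !scaleN1r ![- _ + _]addrC.
Unshelve. all: by end_near. Qed.
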